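(* Let $\pi\colon(T,X)\to(T,Y)$ be a nontrivial extension of minimal compact dynamics. The following are pairwise equivalent: (1) $\pi$ is a PI-extension; (2) every M-dynamic $(T,L)$ with $L$ a closed invariant subset of $\mathtt R_\pi$ is minimal; (3) $(T,\Delta_X)$ is the unique M-dynamic $(T,L)$ with $L$ a closed invariant subset of $\mathtt R_\pi$ containing $\Delta_X$.
   Context: $T$ is a group or monoid, regarded as discrete. An extension is a continuous equivariant surjection; nontrivial means $\mathtt R_\pi\ne\Delta_X$, where $\mathtt R_\pi=\{(x_1,x_2):\pi x_1=\pi x_2\}$ with diagonal action and $\Delta_X$ the diagonal. A point is a.p. if its return times to every neighborhood form a syndetic set; a dynamic is T.T. if $\{t:V\cap tU\ne\emptyset\}\ne\emptyset$ for all nonempty open $U,V$; an M-dynamic is a T.T. dynamic with a dense set of a.p. points. Extension $\pi$ is proximal if $\overline{Tz}\cap\Delta_X\ne\emptyset$ for all $z\in\mathtt R_\pi$; it is a.p. if there is no $(x,x')\in\mathtt R_\pi\setminus\Delta_X$ such that $\overline{T((U\times V)\cap\mathtt R_\pi)}\cap\Delta_X\ne\emptyset$ for all neighborhoods $U$ of $x$ and $V$ of $x'$. $\pi$ is PI if there are a minimal compact dynamic $X'$ and a proximal extension $\rho\colon X'\to X$ such that $\pi'=\pi\circ\rho$ admits a PI-tower: an ordinal $\vartheta$, minimal compact dynamics $Y_\gamma$ ($\gamma\le\vartheta$) with $Y_0=Y$, extensions $\pi'_\gamma\colon X'\to Y_\gamma$ ($\pi'_0=\pi'$) and $\psi_\gamma^{\gamma+1}\colon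 Y_{\gamma+1}\to Y_\gamma$ with $\psi_\gamma^{\gamma+1}\circ\pi'_{\gamma+1}=\pi'_\gamma$, each $\psi_\gamma^{\gamma+1}$ proximal or a.p., $Y_\gamma=\varprojlim_{\lambda<\gamma}Y_\lambda$ for limit ordinals $\gamma$, and $\pi'_\vartheta$ an isomorphism. *)

(* Defs.v *)
From HB Require Import structures.
From mathcomp Require Import all_boot all_order all_algebra.
From mathcomp Require Import all_classical all_reals topology.
Set Implicit Arguments. Unset Strict Implicit. Unset Printing Implicit Defensive.
Local Open Scope classical_set_scope.

(* A monoid (a group is a special case), regarded as discrete. *)
Record monoid := Monoid {
  mcar :> Type;
  mone : mcar;
  mmul : mcar -> mcar -> mcar;
  mmulA : forall a b c, mmul a (mmul b c) = mmul (mmul a b) c;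
  mmul1l : forall a, mmul mone a = a;
  mmul1r : forall a, mmul a mone = a }.

(* A dynamic (T,X): a topological space X with an action of T by continuous maps
   (T discrete, so joint continuity = continuity of each t). *)
Record dynamic (T : monoid) := Dynamic {
  dspace :> topologicalType;
  dact : T -> dspace -> dspace;
  dact1 : forall x, dact (@mone T) x = x;
  dactM : forall s t x, dact (mmul s t) x = dact s (dact t x);
  dact_cont : forall t, continuous (dact t) }.

Section Defs.
Variable T : monoid.

Definition syndetic (S : set T) : Prop :=
  exists K : set T, finite_set K /\ forall t : T, exists k, K k /\ S (mmul k t).

Section OnSpace.
Variables (Z : topologicalType) (act : T -> Z -> Z).

Definition invariant_set (A : set Z) : Prop := forall t z, A z -> A (act t z).

Definition ap_point (z : Z) : Prop :=
  forall U, nbhs z U -> syndetic [set t | U (act t z)].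

Definition TT_set (A : set Z) : Prop :=
  forall U V : set Z, open U -> open V -> U `&` A !=set0 -> V `&` A !=set0 ->
    exists t x, A x /\ U x /\ V (act t x).

Definition M_set (A : set Z) : Prop :=
  A !=set0 /\ TT_set A /\
  (forall W : set Z, open W -> W `&` A !=set0 -> exists z, A z /\ W z /\ ap_point z).

(* (T, A) is minimal (A closed invariant_set): nonempty, no proper nonempty
   closed invariant_set subset *)
Definition minimal_set (A : set Z) : Prop :=
  A !=set0 /\ forall B : set Z, B `<=` A -> B !=set0 -> closed B -> invariant_set B -> B = A.
End OnSpace.

Definition minimal_compact (X : dynamic T) : Prop :=
  compact [set: X] /\ hausdorff_space X /\ minimal_set (@dact T X) [set: X].

Definition act2 (X : dynamic T) (t : T) (z : X * X) : X * X :=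
  (@dact T X t z.1, @dact T X t z.2).
Arguments act2 X t z : clear implicits.

Definition diag (X : Type) : set (X * X) := [set z | z.1 = z.2].
Arguments diag X : clear implicits.

Definition Rel (X Y : Type) (f : X -> Y) : set (X * X) := [set z | f z.1 = f z.2].

Definition extension (X Y : dynamic T) (f : X -> Y) : Prop :=
  continuous f /\ (forall t x, f (@dact T X t x) = @dact T Y t (f x)) /\
  (forall y, exists x, f x = y).

Definition isomorphism (X Y : dynamic T) (f : X -> Y) : Prop :=
  extension f /\ exists g : Y -> X, continuous g /\ cancel f g /\ cancel g f.

Definition proximal_ext (X Y : dynamic T) (f : X -> Y) : Prop :=
  forall z, Rel f z ->
    closure [set w | exists t, w = act2 X t z] `&` diag X !=set0.

Definition ap_ext (X Y : dynamic T) (f : X -> Y) : Prop :=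
  ~ exists x x' : X, f x = f x' /\ x <> x' /\
      forall U V : set X, nbhs x U -> nbhs x' V ->
        closure [set w | exists t a, ((U `*` V) `&` Rel f) a /\ w = act2 X t a]
          `&` diag X !=set0.

Definition strict_well_order (I : Type) (lt : I -> I -> Prop) : Prop :=
  (forall a b c, lt a b -> lt b c -> lt a c) /\
  (forall a b, lt a b \/ a = b \/ lt b a) /\
  well_founded lt.

(* PI-extension.  The ordinal vartheta+1 = {gamma <= vartheta} is represented by a
   well-ordered index type I with greatest element top = vartheta. The bonding
   maps psi l g (l < g) are part of the tower (needed for the inverse limits). *)
Definition PI_ext (X Y : dynamic T) (pi : X -> Y) : Prop :=
  exists (X' : dynamic T) (rho : X' -> X),
    minimal_compact X' /\ extension rho /\ proximal_ext rho /\
    exists (I : Type) (lt : I -> I -> Prop) (top : I),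
      strict_well_order lt /\ (forall g, g = top \/ lt g top) /\
      exists (Yg : I -> dynamic T) (pg : forall g, X' -> Yg g)
             (psi : forall l g : I, Yg g -> Yg l),
        (forall g, minimal_compact (Yg g)) /\
        (forall g, extension (pg g)) /\
        (forall l g, lt l g -> extension (psi l g) /\
                                (forall x, psi l g (pg g x) = pg l x)) /\
        (forall g, (forall l, ~ lt l g) ->
           exists iota : Y -> Yg g, isomorphism iota /\
             forall x, pg g x = iota (pi (rho x))) /\
        (forall g d, lt g d -> (forall m, ~ (lt g m /\ lt m d)) ->
           proximal_ext (psi g d) \/ ap_ext (psi g d)) /\
        (* Y_g = inverse limit of Y_l, l < g, at limit ordinals g *)
        (forall g, (exists l, lt l g) ->
                   (forall l, lt l g -> exists m, lt l m /\ lt m g) ->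
           (forall y1 y2 : Yg g,
              (forall l, lt l g -> psi l g y1 = psi l g y2) -> y1 = y2) /\
           (forall th : forall l, Yg l,
              (forall l m, lt l m -> lt m g -> psi l m (th m) = th l) ->
              exists y : Yg g, forall l, lt l g -> psi l g y = th l)) /\
        isomorphism (pg top).

End Defs.
Arguments diag X : clear implicits.
Arguments act2 T X t z : clear implicits.

(* Main.v *)
(* Every minimal dynamic is a quotient of the universal minimal flow [M], a
   minimal left ideal of the semigroup of ultrafilters on [T], so factors are
   invariant closed equivalence relations (icers) on [M].

   PI implies (2): lift an M-dynamic of [Rel pi] to [X' x X'] and push it down the
   tower.  Its images are minimal by induction: over a proximal step two almost
   periodic points with the same image and fixed by the same idempotent coincide,
   and an a.p. step is distal and equicontinuous, so that transitivity makes all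
   orbit closures over a minimal set equal.

   (3) implies PI: let [R] be the least icer of [M] containing the almost periodic
   pairs of the relation defining [X]; then [M / R] is a proximal extension of
   [X].  Starting from the relation defining [Y], shrink icers above [R] by
   proximal and a.p. steps as long as possible.  At the last icer [S], with
   Ellis group [F] (and [A] that of [R]), no proximal step is left, which forces
   [S] to be the closure of its almost periodic pairs, [(p, q)] with [q] in the
   circle product [p o F]; no a.p. step is left, which forces [F] to be the
   tau-closure of [H A], where [H] is the derived group of [F].  Then the image
   of [S] in [X x X] is an M-dynamic containing the diagonal, hence is the
   diagonal, and so [S = R]. *)
Require Import Defs.
From HB Require Import structures.
From mathcomp Require Import all_boot all_order all_algebra.
From mathcomp Require Import all_classical all_reals topology.
Set Implicit Arguments. Unset Strict Implicit. Unset Printing Implicit Defensive.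
Local Open Scope classical_set_scope.

(** * Ultrafilters and compact spaces *)

Section Ultrafilters.

(** Since [T] is only a monoid, translations cannot be undone. Recurrence replaces their inverses: a
    point fixed by an idempotent of [M] lies in the orbit closure of each of its translates. No
    metrizability is assumed, so compactness takes the place of residual sets. The one Baire-type
    argument takes place in the tau-topology, for an idempotent chosen so that the closure of the
    Ellis group [F] is minimal under right multiplication by [F]. The derived group links a.p. steps
    with transitivity. On the one hand, a cocycle on [circ_rel F] is well behaved modulo
    [derived u F], and each tau-closed subgroup of [F] containing the derived group yields an a.p.
    step. On the other hand, the derived group lies in the closure of every tau-neighborhood of [u].
    So when no a.p. step is left, small open pieces of [F] have circle limits, taken in both
    coordinates at once, that fill the derived group, then its product with [A], which acts
    trivially on [X], then all of [F]; this is transitivity. *)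

Lemma ultraP (W : Type) (F : set_system W) : ProperFilter F ->
  (forall A, F A \/ F (~` A)) -> UltraFilter F.
Proof.
move=> PF FAC; split=> // G PG sFG; rewrite eqEsubset; split=> // A GA.
have [//|/sFG GnA] := FAC A.
have: G (A `&` ~` A) by exact: filterI.
by rewrite setICr => /filter_not_empty.
Qed.

Lemma ultra_not (W : Type) (F : set_system W) (UF : UltraFilter F) (A : set W) :
  ~ F A -> F (~` A).
Proof. by have [|] := in_ultra_setVsetC A UF. Qed.

Lemma ultra_notC (W : Type) (F : set_system W) (UF : UltraFilter F) (A : set W) :
  F A -> F (~` A) -> False.
Proof.
move=> FA FnA; have : F (A `&` ~` A) by exact: filterI.
by rewrite setICr => /filter_not_empty.
Qed.

Lemma ultraU (W : Type) (F : set_system W) (UF : UltraFilter F) (A B : set W) :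
  F (A `|` B) -> F A \/ F B.
Proof.
move=> FAB; have [|/(ultra_not UF) FnA] := pselect (F A); first by left.
right; have : F ((A `|` B) `&` ~` A) by exact: filterI.
by apply: filterS => w [[]].
Qed.

Lemma ultra_fmap (V W : Type) (f : V -> W) (F : set_system V) :
  UltraFilter F -> UltraFilter [set A | F (f @^-1` A)].
Proof.
move=> UF; apply: ultraP => A; rewrite /= preimage_setC.
exact: in_ultra_setVsetC.
Qed.

Lemma ultra_lim (Z : topologicalType) (W : Type) (F : set_system W)
    (f : W -> Z) : compact [set: Z] -> UltraFilter F ->
  exists z : Z, forall V, nbhs z V -> F (f @^-1` V).
Proof.
rewrite compact_ultra => cZ UF.
have [|z [_ Fz]] := cZ _ (ultra_fmap f UF); first by rewrite /= preimage_setT; exact: filterT.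
by exists z => V /Fz.
Qed.

Lemma ultra_lim_uniq (Z : topologicalType) (W : Type) (F : set_system W)
    (f : W -> Z) (y z : Z) : hausdorff_space Z -> UltraFilter F ->
  (forall V, nbhs y V -> F (f @^-1` V)) ->
  (forall V, nbhs z V -> F (f @^-1` V)) -> y = z.
Proof.
move=> hZ UF Fy Fz; apply: hZ => A B /Fy FA /Fz FB.
have /filter_ex[w [wA wB]] : F (f @^-1` A `&` f @^-1` B) by exact: filterI.
by exists (f w).
Qed.

Lemma ultra_base (W : Type) (B : set (set W)) :
  B !=set0 -> (forall A C, B A -> B C -> exists D, B D /\ D `<=` A `&` C) ->
  (forall A, B A -> A !=set0) -> exists F, UltraFilter F /\ B `<=` F.
Proof.
move=> B0 BI Bne.
have PF : ProperFilter (filter_from B id).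
  apply: filter_from_proper => //; apply: filter_from_filter => //.
  by move=> A C BA BC; have [D [BD sD]] := BI _ _ BA BC; exists D.
have [F [UF sF]] := ultraFilterLemma PF.
by exists F; split=> // A BA; apply: sF; exists A.
Qed.

Lemma ultra_ext (W : Type) (B : set (set W)) :
  B setT -> (forall A C, B A -> B C -> exists D, B D /\ D `<=` A `&` C) ->
  (forall A, B A -> A !=set0) -> exists F, UltraFilter F /\ B `<=` F.
Proof. by move=> BT; apply: ultra_base; exists setT. Qed.

End Ultrafilters.

(** * Compact Hausdorff spaces, chains of closed sets and minimal closed sets *)

Section Topology.
Variable Z : topologicalType.
Hypothesis cZ : compact [set: Z].
Hypothesis hZ : hausdorff_space Z.

Lemma regular_nbhs (z : Z) V : nbhs z V ->
  exists W, [/\ nbhs z W, closed W & W `<=` V].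
Proof.
move=> zV.
have [W zW WV] := compact_regular hZ cZ (filterT : nbhs z setT) zV.
exists (closure W); split=> //; last exact: closed_closure.
by apply: filterS zW; exact: subset_closure.
Qed.

Lemma chain_cap (C : set (set Z)) : C !=set0 ->
  (forall A, C A -> closed A) -> (forall A, C A -> A !=set0) ->
  total_on C (fun A B => A `<=` B) -> \bigcap_(A in C) A !=set0.
Proof.
move=> [A0 CA0] Ccl Cne Ctot.
have [|A B [->|CA] [->|CB]|A [->|CA]|F [UF CF]] :=
    @ultra_ext _ (fun A => A = setT \/ C A); first by left.
- by exists setT; rewrite setIT; split=> //; left.
- by exists B; rewrite setTI; split=> //; right.
- by exists A; rewrite setIT; split=> //; right.
- have [AB|BA] := Ctot _ _ CA CB.
    by exists A; split; [right|move=> z Az; split=> //; exact: AB].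
  by exists B; split; [right|move=> z Bz; split=> //; exact: BA].
- by have [a _] := Cne _ CA0; exists a.
- exact: Cne.
have [z Fz] := ultra_lim id cZ UF; exists z => A CA.
apply: Ccl => // V /Fz FV.
have FA : F A by apply: (CF A); right.
exact: (filter_ex (filterI FA FV)).
Qed.

Lemma zorn_min (P : set (set Z)) (A : set Z) : P A ->
  (forall C : set (set Z), C !=set0 -> C `<=` P ->
     total_on C (fun A B => A `<=` B) -> P (\bigcap_(B in C) B)) ->
  exists B, [/\ P B, B `<=` A & forall D, P D -> D `<=` B -> D = B].
Proof.
move=> PA Pcap.
pose I := {B : set Z | P B /\ B `<=` A}.
pose R (s t : I) := `[< sval t `<=` sval s >].
have := @Zorn I R.
case=> [s|r s t /asboolP rs /asboolP st|s t /asboolP st /asboolP ts|C Ctot|].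
- exact/asboolP.
- by apply/asboolP; exact: subset_trans rs.
- case: s st ts => s Ps; case: t => t Pt /= st ts.
  have E : s = t by rewrite eqEsubset.
  by move: Ps; rewrite E => Ps; rewrite (Prop_irrelevance Ps Pt).
(* The hypothesis on intersections concerns nonempty chains only; the empty chain is bounded by [A]
   itself. *)
- have [[c Cc]|C0] := pselect (C !=set0); last first.
    by exists (exist (fun B => P B /\ B `<=` A) A (conj PA (@subset_refl _ A))) => s Cs; case: C0; exists s.
  have PB : P (\bigcap_(B in sval @` C) B).
    apply: Pcap; first by exists (sval c); exists c.
      by move=> B [s _ <-]; case: s => /= ? [].
    move=> _ _ [s Cs <-] [t Ct <-].
    by have [/asboolP|/asboolP] := Ctot _ _ Cs Ct; [right|left].
  have BA : \bigcap_(B in sval @` C) B `<=` A.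
    by move=> z zB; apply: (proj2 (proj2_sig c)); apply: zB; exists c.
  exists (exist (fun B => P B /\ B `<=` A) _ (conj PB BA)) => s Cs; apply/asboolP => z /= zB.
  by apply: zB; exists s.
move=> [B [PB BA]] Bmin; exists B; split=> // D PD DB.
have DA : D `<=` A by exact: (subset_trans DB BA).
have := Bmin (exist (fun B => P B /\ B `<=` A) D (conj PD DA)).
by move=> /(_ (asboolT DB)) [].
Qed.

(** The index type of [act] is arbitrary and the maps need not be continuous, so this serves both
    [T] acting on ultrafilters and an Ellis group acting by right multiplication. *)
Lemma min_inv (I : Type) (act : I -> Z -> Z) (A : set Z) :
  A !=set0 -> closed A -> (forall i z, A z -> A (act i z)) ->
  exists B, [/\ B !=set0, closed B, (forall i z, B z -> B (act i z)), B `<=` A &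
    forall D, D !=set0 -> closed D -> (forall i z, D z -> D (act i z)) ->
      D `<=` B -> D = B].
Proof.
move=> A0 cA iA.
have [|C C0 CP Ctot|B [[B0 cB iB] BA Bmin]] := @zorn_min
  (fun B => [/\ B !=set0, closed B & forall i z, B z -> B (act i z)]) A.
- by split.
- split.
  + by apply: chain_cap => // B /CP[].
  + by apply: closed_bigI => B /CP[].
  + by move=> i z Cz B CB; have [_ _ iB] := CP _ CB; apply: iB; exact: Cz.
- by exists B; split=> // D D0 cD iD DB; apply: Bmin.
Qed.

End Topology.

Lemma closed_image (Y Z : topologicalType) (f : Y -> Z) (A : set Y) :
  compact [set: Y] -> hausdorff_space Z -> continuous f -> closed A ->
  closed (f @` A).
Proof.
move=> cY hZ cf cA; apply: compact_closed => //; apply: continuous_compact.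
  exact: continuous_subspaceT.
exact: subclosed_compact cA cY _.
Qed.

Lemma bij_inv_continuous (Y Z : topologicalType) (f : Y -> Z) (g : Z -> Y) :
  compact [set: Y] -> hausdorff_space Z -> continuous f ->
  cancel f g -> cancel g f -> continuous g.
Proof.
move=> cY hZ cf fK gK; apply/continuous_closedP => A cA.
have -> : g @^-1` A = f @` A.
  rewrite eqEsubset; split=> z /=; first by exists (g z).
  by move=> [y Ay <-]; rewrite fK.
exact: closed_image.
Qed.

Lemma closed_preim (Y Z : topologicalType) (f : Y -> Z) (A : set Z) :
  continuous f -> closed A -> closed (f @^-1` A).
Proof. by move=> /continuous_closedP; apply. Qed.

Lemma closed_equalizer (Y Z : topologicalType) (f g : Y -> Z) :
  hausdorff_space Z -> continuous f -> continuous g ->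
  closed [set y | f y = g y].
Proof.
move=> hZ cf cg y yc; apply: hZ => A B fA gB.
have : nbhs y (f @^-1` A `&` g @^-1` B) by apply: filterI; [exact: cf|exact: cg].
by move=> /yc [x /= [fg [xA xB]]]; exists (f x); split=> //; rewrite fg.
Qed.

Lemma pair_continuous (X Y Z : topologicalType) (f : X -> Y) (g : X -> Z) :
  continuous f -> continuous g -> continuous (fun x => (f x, g x)).
Proof. by move=> cf cg x; apply: cvg_pair; [exact: cf|exact: cg]. Qed.

Lemma fst_continuous (Y Z : topologicalType) : continuous (@fst Y Z).
Proof. by move=> z; exact: cvg_fst. Qed.

Lemma snd_continuous (Y Z : topologicalType) : continuous (@snd Y Z).
Proof. by move=> z; exact: cvg_snd. Qed.

Lemma continuous_comp' (X Y Z : topologicalType) (f : X -> Y) (g : Y -> Z) :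
  continuous f -> continuous g -> continuous (g \o f).
Proof. by move=> cf cg x; apply: continuous_comp; [exact: cf|exact: cg]. Qed.

Lemma prod_hausdorff (Y Z : topologicalType) :
  hausdorff_space Y -> hausdorff_space Z -> hausdorff_space (Y * Z)%type.
Proof.
move=> hY hZ [y z] [y' z'] cl.
have -> : y = y'.
  apply: hY => A B yA yB.
  have [||[a b] [/= [aA _] [aB _]]] := cl (A `*` setT) (B `*` setT); last by exists a.
  - by exists (A, setT) => //=; split=> //; exact: filterT.
  - by exists (B, setT) => //=; split=> //; exact: filterT.
have -> // : z = z'.
apply: hZ => A B yA yB.
have [||[a b] [/= [_ aA] [_ aB]]] := cl (setT `*` A) (setT `*` B); last by exists b.
- by exists (setT, A) => //=; split=> //; exact: filterT.
- by exists (setT, B) => //=; split=> //; exact: filterT.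
Qed.

(** * The action of the Stone-Cech compactification *)

Record cdyn (T : monoid) := CDyn {
  cdynamic :> dynamic T;
  cdyn_compact : compact [set: cdynamic];
  cdyn_haus : hausdorff_space cdynamic }.
#[global] Hint Resolve cdyn_compact cdyn_haus : core.

Section ProdDyn.
Variables (T : monoid) (Y Z : dynamic T).

Definition prod_act (t : T) (w : Y * Z) : Y * Z := (dact t w.1, dact t w.2).

Lemma prod_act1 w : prod_act (mone T) w = w.
Proof. by case: w => y z; rewrite /prod_act !dact1. Qed.

Lemma prod_actM s t w : prod_act (mmul s t) w = prod_act s (prod_act t w).
Proof. by rewrite /prod_act !dactM. Qed.

Lemma prod_act_cont t : continuous (prod_act t).
Proof.
apply: pair_continuous.
  exact: continuous_comp' (@fst_continuous _ _) (@dact_cont _ _ t).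
exact: continuous_comp' (@snd_continuous _ _) (@dact_cont _ _ t).
Qed.

Definition prod_dyn : dynamic T := Dynamic prod_act1 prod_actM prod_act_cont.
End ProdDyn.

Definition prod_cdyn (T : monoid) (Y Z : cdyn T) : cdyn T.
Proof.
apply: (@CDyn T (prod_dyn Y Z)); last exact: prod_hausdorff.
by rewrite -setXTT; apply: compact_setX.
Defined.

(** * The flow and the semigroup of ultrafilters on [T] *)

Section StoneCech.
Variable T : monoid.

Definition bT : Type := {F : set_system T | UltraFilter F}.

HB.instance Definition _ := gen_eqMixin bT.
HB.instance Definition _ := gen_choiceMixin bT.

Definition bT_open (O : set bT) :=
  forall xi, O xi -> exists2 P, sval xi P & forall eta : bT, sval eta P -> O eta.

Lemma bT_openT : bT_open setT.
Proof. by move=> xi _; exists setT => //; case: xi => F UF; exact: filterT. Qed.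

Lemma bT_openI A B : bT_open A -> bT_open B -> bT_open (A `&` B).
Proof.
move=> oA oB xi [/oA [P xiP PA] /oB [Q xiQ QB]].
case: xi xiP xiQ => F UF /= FP FQ; exists (P `&` Q); first exact: filterI.
move=> eta etaPQ; split.
  by apply: PA; case: eta etaPQ => G UG; apply: filterS => ? [].
by apply: QB; case: eta etaPQ => G UG; apply: filterS => ? [].
Qed.

Lemma bT_openU (I : Type) (f : I -> set bT) :
  (forall i, bT_open (f i)) -> bT_open (\bigcup_i f i).
Proof.
move=> of_ xi [i _ /of_[P xiP PA]]; exists P => // eta /PA ?; by exists i.
Qed.

HB.instance Definition _ :=
  @isOpenTopological.Build bT bT_open bT_openT bT_openI bT_openU.

Lemma bT_openE (O : set bT) : open O = bT_open O.
Proof. by []. Qed.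

Lemma bT_nbhsP (xi : bT) (V : set bT) :
  nbhs xi V <-> exists2 P, sval xi P & forall eta : bT, sval eta P -> V eta.
Proof.
split.
  rewrite nbhsE => -[O [oO Oxi] OV]; rewrite bT_openE in oO.
  by have [P xiP PO] := oO _ Oxi; exists P => // eta /PO /OV.
move=> [P xiP PV]; rewrite nbhsE; exists [set eta : bT | sval eta P] => //.
by split=> //; rewrite bT_openE => eta etaP; exists P.
Qed.

#[global] Instance bT_ultra (xi : bT) : UltraFilter (sval xi). Proof. exact: proj2_sig. Qed.

Lemma bT_ext (xi eta : bT) : (forall P, sval xi P -> sval eta P) -> xi = eta.
Proof.
case: xi => F UF; case: eta => G UG /= FG.
have E : F = G by rewrite eqEsubset; split=> // P GP; have [//|/FG GnP] := in_ultra_setVsetC P UF; case: (ultra_notC UG GP GnP).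
by move: UF FG; rewrite E => UF _; rewrite (Prop_irrelevance UF UG).
Qed.

Lemma bT_compact : compact [set: bT].
Proof.
rewrite compact_ultra => F UF _.
have UG : UltraFilter [set P | F [set eta : bT | sval eta P]].
  refine (@ultraP _ _ _ _); last first => [P|].
    have [|/= nF] := in_ultra_setVsetC [set eta : bT | sval eta P] UF; first by left.
    by right; apply: filterS nF => -[G UG] /= ?; exact: ultra_not.
  split=> /=; first by move=> /filter_ex[[G UG]] /=; exact: filter_not_empty.
  split=> /=.
  - by apply: (@filterS _ F _ setT) (filterT) => -[G UG] _ /=; exact: filterT.
  - move=> P Q FP FQ; apply: (@filterS _ F) (@filterI _ F _ _ _ FP FQ) => -[G UG] /= [GP GQ].
    exact: filterI.
  - by move=> P Q PQ; apply: (@filterS _ F) => -[G UG] /=; exact: filterS.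
exists (exist _ _ UG); split=> // V /bT_nbhsP[P /= FP PV].
by apply: filterS FP => eta /PV.
Qed.

Lemma bT_haus : hausdorff_space bT.
Proof.
move=> xi eta cl; apply: bT_ext => P xiP; apply: contrapT => netaP.
have /(ultra_not (bT_ultra eta)) etaP := netaP.
have [||z [/= zP zn]] := cl [set z | sval z P] [set z | sval z (~` P)].
- by apply/bT_nbhsP; exists P.
- by apply/bT_nbhsP; exists (~` P).
exact: (ultra_notC (bT_ultra z) zP zn).
Qed.

Definition bT_act (t : T) (xi : bT) : bT :=
  exist _ _ (ultra_fmap (mmul t) (bT_ultra xi)).

Lemma bT_act1 xi : bT_act (mone T) xi = xi.
Proof. by apply: bT_ext => P /=; apply: filterS => s /=; rewrite mmul1l. Qed.

Lemma bT_actM s t xi : bT_act (mmul s t) xi = bT_act s (bT_act t xi).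
Proof.
by apply: bT_ext => P /=; apply: filterS => r /=; rewrite mmulA.
Qed.

Lemma bT_act_cont t : continuous (bT_act t).
Proof.
move=> xi V /bT_nbhsP [P /= xiP PV]; apply/bT_nbhsP.
by exists [set s | P (mmul t s)] => // eta etaP; exact: PV.
Qed.

Definition bT_dyn : cdyn T :=
  @CDyn T (Dynamic bT_act1 bT_actM bT_act_cont) bT_compact bT_haus.

Lemma bmul_ultra (xi eta : bT) :
  UltraFilter [set P | sval xi [set t | sval eta [set s | P (mmul t s)]]].
Proof.
have Ux := bT_ultra xi; have Ue := bT_ultra eta.
refine (@ultraP _ _ _ _); last first => [P|].
  have [|xin] := in_ultra_setVsetC [set t | sval eta [set s | P (mmul t s)]] Ux.
    by left.
  by right; apply: filterS xin => t /=; exact: ultra_not.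
split=> /=.
  by move=> /filter_ex[t] /filter_ex[].
split=> /=.
- by apply: (@filterS _ (sval xi) _ setT) (filterT) => t _; exact: filterT.
- move=> P Q xiP xiQ; apply: (@filterS _ (sval xi)) (@filterI _ (sval xi) _ _ _ xiP xiQ) => t [eP eQ].
  exact: filterI eP eQ.
- move=> P Q PQ; apply: (@filterS _ (sval xi)) => t /=.
  by apply: (@filterS _ (sval eta)) => s; exact: PQ.
Qed.

(** Convolution of ultrafilters, continuous in [xi] for fixed [eta]. *)
Definition bmul (xi eta : bT) : bT := exist _ _ (bmul_ultra xi eta).

Definition bpr (t : T) : bT := exist _ _ (principal_filter_ultra t).

End StoneCech.

Section Bt.
Variables (T : monoid) (xi : bT T).
Implicit Types P Q : set T.

Lemma btT : sval xi setT. Proof. exact: (@filterT _ (sval xi) _). Qed.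

Lemma btS P Q : P `<=` Q -> sval xi P -> sval xi Q.
Proof. exact: (@filterS _ (sval xi) _). Qed.

Lemma btI P Q : sval xi P -> sval xi Q -> sval xi (P `&` Q).
Proof. exact: (@filterI _ (sval xi) _). Qed.

Lemma btN P : ~ sval xi P -> sval xi (~` P).
Proof. by move=> nP; apply: ultra_not. Qed.

Lemma btU P Q : sval xi (P `|` Q) -> sval xi P \/ sval xi Q.
Proof. by move=> PQ; apply: ultraU. Qed.

Lemma bt_ex P : sval xi P -> exists t, P t.
Proof. exact: (@filter_ex _ (sval xi) _). Qed.

Lemma bt_exI P Q : sval xi P -> sval xi Q -> exists t, P t /\ Q t.
Proof. by move=> xiP xiQ; have [t [? ?]] := bt_ex (btI xiP xiQ); exists t. Qed.
End Bt.

(** * Ultrafilters acting on points and on sets *)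

Section Action.
Variables (T : monoid) (Z : cdyn T).
Implicit Types (xi eta : bT T) (z : Z) (A B C : set Z).

(* The limit of [t z] as [t] tends to the ultrafilter [xi]. *)
Definition uact xi z : Z :=
  xget z [set y : Z | forall V, nbhs y V -> sval xi [set t | V (dact t z)]].

Lemma uactP xi z V : nbhs (uact xi z) V -> sval xi [set t | V (dact t z)].
Proof.
rewrite /uact; case: xgetP => [y _ yP|noP]; first exact: yP.
have [y yP] := @ultra_lim Z _ _ (fun t => dact t z) (@cdyn_compact _ Z) (bT_ultra xi).
by case: (noP y).
Qed.

Lemma uact_uniq xi z y :
  (forall V, nbhs y V -> sval xi [set t | V (dact t z)]) -> uact xi z = y.
Proof.
move=> yP; apply: (ultra_lim_uniq (@cdyn_haus _ Z) (bT_ultra xi)) yP => V.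
exact: uactP.
Qed.

Lemma dact_nbhs t z V : nbhs (dact t z) V -> nbhs z [set y | V (dact t y)].
Proof. by move=> zV; exact: (@dact_cont _ _ t z). Qed.

Lemma dact_closed t A : closed A -> closed [set y : Z | A (dact t y)].
Proof. by move=> cA; apply: closed_preim cA; exact: dact_cont. Qed.

Lemma cdyn_regular z V : nbhs z V ->
  exists W : set Z, [/\ nbhs z W, closed W & W `<=` V].
Proof. exact: regular_nbhs. Qed.

Lemma uact_closed xi z A : closed A -> sval xi [set t | A (dact t z)] ->
  A (uact xi z).
Proof.
move=> cA xiA; apply: cA => V /uactP xiV.
by have [t [/= ? ?]] := bt_exI xiA xiV; exists (dact t z).
Qed.

Lemma uact_bmul xi eta z : uact (bmul xi eta) z = uact xi (uact eta z).
Proof.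
apply: uact_uniq => V /nbhs_interior/uactP /=; apply: btS => t /= /dact_nbhs.
by move=> /uactP; apply: btS => s /=; rewrite dactM.
Qed.

Lemma uact_act xi t z : uact (bT_act t xi) z = dact t (uact xi z).
Proof.
apply: uact_uniq => V /dact_nbhs/uactP /=.
by apply: btS => s /=; rewrite dactM.
Qed.

Lemma uact_inv xi A z : closed A -> (forall t y, A y -> A (dact t y)) -> A z ->
  A (uact xi z).
Proof.
by move=> cA iA Az; apply: uact_closed => //; apply: btS (btT xi) => t _; exact: iA.
Qed.

Lemma uact_continuous z : continuous (fun xi : bT_dyn T => uact xi z).
Proof.
move=> xi V xV; have [W [xW cW WV]] := cdyn_regular xV.
apply/bT_nbhsP; exists [set t | W (dact t z)]; first exact: uactP.
by move=> eta etaW; apply: WV; exact: uact_closed.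
Qed.

Lemma orbit_closure z y : closure [set w : Z | exists t, w = dact t z] y <->
  exists xi, y = uact xi z.
Proof.
split=> [cy|[xi ->] V /uactP/bt_ex[t tV]]; last by exists (dact t z); split=> //; exists t.
have [||A|F [UF BF]] := @ultra_ext T (fun P => exists2 V : set Z, nbhs y V & P = [set t | V (dact t z)]).
- by exists setT => //; exact: filterT.
- move=> _ _ [V yV ->] [W yW ->]; exists [set t | (V `&` W) (dact t z)].
  by split=> //; exists (V `&` W) => //; exact: filterI.
- by move=> [V /cy[_ [[t ->] tV]] ->]; exists t.
exists (exist _ F UF); apply/esym/uact_uniq => V yV /=.
by apply: BF; exists V.
Qed.

(* The limit of the sets [t A] along [xi] in the hyperspace of [Z], i.e. the circle
   operation, described without topologizing the hyperspace. *)
Definition circ xi A : set Z :=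
  [set z | forall V, nbhs z V -> sval xi [set t | exists2 a, A a & V (dact t a)]].

Lemma circS xi A B : A `<=` B -> circ xi A `<=` circ xi B.
Proof.
by move=> AB z zA V /zA; apply: btS => t [a /AB Ba taV]; exists a.
Qed.

Lemma circ_uact xi A a : A a -> circ xi A (uact xi a).
Proof. by move=> Aa V /uactP; apply: btS => t ?; exists a. Qed.

Lemma circ_closure xi A a : closure A a -> circ xi A (uact xi a).
Proof.
move=> Aa V /nbhs_interior/uactP; apply: btS => t /= /dact_nbhs /Aa[b [Ab bV]].
by exists b => //; exact: (nbhs_singleton bV).
Qed.

Lemma circU xi A B : circ xi (A `|` B) `<=` circ xi A `|` circ xi B.
Proof.
move=> z zAB; apply: contrapT => /not_orP[nA nB].
have /existsNP[V /not_implyP[zV nV]] := nA.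
have /existsNP[W /not_implyP[zW nW]] := nB.
have zVW : nbhs z (V `&` W) by exact: filterI.
have xiAB := zAB _ zVW.
have : sval xi ([set t | exists2 a, A a & V (dact t a)] `|` [set t | exists2 a, B a & W (dact t a)]).
  by apply: btS xiAB => t [a [Aa|Ba] [aV aW]]; [left|right]; exists a.
by move=> /btU[].
Qed.

(** Compactness enters the circle operation here: points of [t A] in [C] are chosen for each [t],
    and their limit along [xi] is the required point. *)
Lemma circ_meet xi A C : closed C -> sval xi [set t | exists2 a, A a & C (dact t a)] ->
  exists2 z, circ xi A z & C z.
Proof.
move=> cC xiC.
have [t0 [a0 _ _]] := bt_ex xiC.
(* For the other [t], which [xi] ignores, [f t] is the dummy value [a0]. *)
have /choice[f fP] : forall t, exists y : Z, (exists2 a, A a & C (dact t a)) ->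
    exists2 a, A a & y = dact t a /\ C y.
  move=> t; have [[a Aa taC]|nA] := pselect (exists2 a, A a & C (dact t a)).
    by exists (dact t a) => _; exists a.
  by exists a0.
have [z zP] := @ultra_lim Z _ _ f (@cdyn_compact _ Z) (bT_ultra xi).
exists z; last first.
  by apply: cC => V /zP xiV; have [t [/fP[a Aa [fE Cf]] fV]] := bt_exI xiC xiV; exists (f t).
move=> V /zP xiV; apply: btS (btI xiC xiV) => t [/fP[a Aa [fE Cf]] /= fV].
by exists a => //; rewrite -fE.
Qed.

(** The harder inclusion must produce actual points of [circ eta A]; [circ_meet] gives them once the
    neighborhood is shrunk to a closed one. *)
Lemma circ_bmul xi eta A : circ xi (circ eta A) = circ (bmul xi eta) A.
Proof.
rewrite eqEsubset; split=> z zA V.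
  move=> /nbhs_interior/zA /=; apply: btS => t /= [b bA /dact_nbhs/bA] {b bA}.
  by apply: btS => s [a Aa taV]; exists a => //; rewrite dactM.
move=> /cdyn_regular[W [/zA zW cW WV]].
have {}zW : sval xi [set t | sval eta [set s | exists2 a, A a & W (dact (mmul t s) a)]] := zW.
apply: btS zW => t /= etaA.
have [|y yA tyW] := @circ_meet eta A [set y | W (dact t y)] (dact_closed cW).
  by apply: btS etaA => s /= [a Aa]; rewrite dactM; exists a.
by exists y => //; exact: WV.
Qed.

Lemma circ_inv xi A B : closed B -> (forall t y, B y -> B (dact t y)) ->
  A `<=` B -> circ xi A `<=` B.
Proof.
move=> cB iB AB z zA; apply: cB => V /zA/bt_ex[t [a Aa taV]].
by exists (dact t a); split=> //; apply: iB; exact: AB.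
Qed.

Lemma circ_dact xi t A z : circ xi A z -> circ (bT_act t xi) A (dact t z).
Proof.
move=> zA V /dact_nbhs/zA /=; apply: btS => s /= [a Aa].
by rewrite -dactM; exists a.
Qed.

Lemma circ_closed_rel xi z A : ~ circ xi A z -> exists P (V : set Z),
  [/\ sval xi P, nbhs z V & forall (eta : bT T) y, sval eta P -> V y -> ~ circ eta A y].
Proof.
move=> /existsNP[V /not_implyP[zV /btN nV]].
exists (~` [set t | exists2 a, A a & V (dact t a)]), (interior V).
split=> //; first exact: nbhs_interior.
move=> eta y etaP Vy yA; have yV := yA _ Vy.
by have [t []] := bt_exI etaP yV.
Qed.

End Action.

Lemma uact_morph (T : monoid) (Y Z : cdyn T) (f : Y -> Z) xi y :
  continuous f -> (forall t y, f (dact t y) = dact t (f y)) ->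
  f (uact xi y) = uact xi (f y).
Proof.
move=> cf ef; apply/esym/uact_uniq => V /cf/uactP.
by apply: btS => t /=; rewrite ef.
Qed.

Lemma circ_morph (T : monoid) (Y Z : cdyn T) (f : Y -> Z) xi (A : set Y) y :
  continuous f -> (forall t y, f (dact t y) = dact t (f y)) ->
  circ xi A y -> circ xi (f @` A) (f y).
Proof.
move=> cf ef yA V /cf/yA; apply: btS => t /= [a Aa]; rewrite ef => faV.
by exists (f a) => //; exists a.
Qed.

Lemma circ_prod (T : monoid) (Y Z : cdyn T) xi (A : set Y) (B : set Z) y z :
  circ xi A y -> circ xi B z ->
  @circ T (prod_cdyn Y Z) xi (A `*` B) (y, z).
Proof.
move=> yA zB W [[V1 V2] /= [/yA xiA /zB xiB] VW].
apply: btS (btI xiA xiB) => t [[a Aa taV] [b Bb tbV]].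
by exists (a, b) => //; apply: VW.
Qed.

Lemma uact_prod (T : monoid) (Y Z : cdyn T) xi (y : Y) (z : Z) :
  @uact T (prod_cdyn Y Z) xi (y, z) = (uact xi y, uact xi z).
Proof.
apply: uact_uniq => W [[V1 V2] /= [/uactP xiA /uactP xiB] VW].
by apply: btS (btI xiA xiB) => t [? ?]; apply: VW.
Qed.

Lemma uact_bT (T : monoid) (xi eta : bT_dyn T) : uact xi eta = bmul xi eta.
Proof.
apply: uact_uniq => V /bT_nbhsP[P /= xiP PV].
by apply: btS xiP => t /= etaP; exact: PV.
Qed.

(** * Quotients and the universal minimal flow *)

Record is_icer (T : monoid) (Z : dynamic T) (S : set (Z * Z)) : Prop := IsIcer {
  icer_closed : closed S;
  icer_refl : forall p, S (p, p);
  icer_sym : forall p q, S (p, q) -> S (q, p);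
  icer_trans : forall p q r, S (p, q) -> S (q, r) -> S (p, r);
  icer_act : forall t p q, S (p, q) -> S (dact t p, dact t q) }.

Section Quotient.
Variables (T : monoid) (Z : cdyn T) (S : set (Z * Z)).

Definition qt : Type := {c : set Z | exists p, c = [set q | S (p, q)]}.

HB.instance Definition _ := gen_eqMixin qt.
HB.instance Definition _ := gen_choiceMixin qt.

Definition cls (p : Z) : qt :=
  exist _ [set q | S (p, q)] (ex_intro _ p erefl).

Definition rep (c : qt) : Z := sval (cid (proj2_sig c)).

Definition qt_open (O : set qt) := open (cls @^-1` O).

Lemma qt_openT : qt_open setT.
Proof. by rewrite /qt_open preimage_setT; exact: openT. Qed.

Lemma qt_openI A B : qt_open A -> qt_open B -> qt_open (A `&` B).
Proof. exact: openI. Qed.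

Lemma qt_openU (I : Type) (f : I -> set qt) :
  (forall i, qt_open (f i)) -> qt_open (\bigcup_i f i).
Proof. by move=> of_; apply: bigcup_open => i _; exact: of_. Qed.

HB.instance Definition _ :=
  @isOpenTopological.Build qt qt_open qt_openT qt_openI qt_openU.

Lemma qt_openE (O : set qt) : open O = open (cls @^-1` O).
Proof. by []. Qed.

Lemma cls_continuous : continuous cls.
Proof. by apply/continuousP. Qed.

Lemma qt_continuous (W : topologicalType) (f : qt -> W) :
  continuous (f \o cls) -> continuous f.
Proof. by move=> /continuousP cf; apply/continuousP => A /cf. Qed.

Lemma repK c : cls (rep c) = c.
Proof.
rewrite /rep; case: cid => p /=; case: c => c cP /= E.
by rewrite /cls; move: cP; rewrite E => cP; rewrite (Prop_irrelevance cP (ex_intro _ p erefl)).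
Qed.

Hypothesis hS : is_icer S.

Lemma cls_eq p q : cls p = cls q <-> S (p, q).
Proof.
split=> [[E]|Spq].
  by have : [set r | S (q, r)] q by [exact: icer_refl]; rewrite -E.
rewrite /cls.
have E : [set r | S (p, r)] = [set r | S (q, r)].
  rewrite eqEsubset; split=> r /=; last exact: icer_trans.
  by apply: icer_trans => //; exact: icer_sym.
move: (ex_intro _ p _) (ex_intro _ q _); rewrite E => H H'.
by rewrite (Prop_irrelevance H H').
Qed.

Lemma rep_cls p : S (p, rep (cls p)).
Proof. by apply/cls_eq; rewrite repK. Qed.

Lemma qt_compact : compact [set: qt].
Proof.
have -> : [set: qt] = cls @` setT.
  by rewrite eqEsubset; split=> c _ //=; exists (rep c) => //; exact: repK.
apply: continuous_compact => //.
exact: continuous_subspaceT cls_continuous.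
Qed.

(** Upper semicontinuity of the classes: the complement is the projection of a closed subset of a
    compact square. *)
Lemma sat_open (O : set Z) : open O -> open [set p | [set q | S (p, q)] `<=` O].
Proof.
move=> oO.
have -> : [set p | [set q | S (p, q)] `<=` O] = ~` (fst @` (S `&` (snd @^-1` (~` O)))).
  rewrite eqEsubset; split=> p /= pO.
    by move=> [[p' q]] /= [Spq nO] E; apply: nO; apply: pO; rewrite -E.
  by move=> q Spq; apply: contrapT => nO; apply: pO; exists (p, q).
apply: closed_openC; apply: (@closed_image (Z * Z)%type Z) => //.
- exact: (@cdyn_compact _ (prod_cdyn Z Z)).
- exact: fst_continuous.
- apply: closedI; first exact: icer_closed.
  by apply: closed_preim; [exact: snd_continuous|exact: open_closedC].
Qed.

Lemma class_closed p : closed [set q | S (p, q)].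
Proof.
apply: (@closed_preim _ _ (fun q => (p, q)) S); last exact: icer_closed.
by apply: pair_continuous => x; [exact: cvg_cst|exact: cvg_id].
Qed.

Lemma qt_haus : hausdorff_space qt.
Proof.
move=> c d cd; apply: contrapT; rewrite -(repK c) -(repK d) => /cls_eq nS.
set p := rep c in nS; set q := rep d in nS.
have nN : set_nbhs [set r | S (p, r)] (~` [set r | S (q, r)]).
  apply/set_nbhsP; exists (~` [set r | S (q, r)]); split=> //.
    exact/closed_openC/class_closed.
  move=> r /= Spr Sqr; apply: nS; exact: (icer_trans hS Spr (icer_sym hS Sqr)).
have [U /set_nbhsP[O [oO pO OU]] Uq] :=
  compact_normal (@cdyn_haus _ Z) (@cdyn_compact _ Z) (@class_closed p) nN.
pose O1 := [set r | [set s | S (r, s)] `<=` O].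
pose O2 := [set r | [set s | S (r, s)] `<=` ~` closure U].
(* The saturated interiors of disjoint neighborhoods of the two classes separate
   them. *)
have satP (W : set Z) r s : S (r, s) -> [set r' | S (r, r')] `<=` W ->
    [set r' | S (s, r')] `<=` W.
  by move=> Srs sW r' Ssr'; apply: sW; exact: (icer_trans hS Srs Ssr').
have nb (W : set Z) e : open W -> [set r | S (rep e, r)] `<=` W ->
    nbhs e [set e' | [set s | S (rep e', s)] `<=` W].
  move=> oW eW; apply: open_nbhs_nbhs; split=> //; rewrite qt_openE.
  rewrite (_ : _ @^-1` _ = [set r | [set s | S (r, s)] `<=` W]); first exact: sat_open.
  rewrite eqEsubset; split=> r /=; apply: satP; last exact: rep_cls.
  by apply: icer_sym => //; exact: rep_cls.
have [||e [/= e1 e2]] := cd [set e | [set s | S (rep e, s)] `<=` O]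
     [set e | [set s | S (rep e, s)] `<=` ~` closure U].
- exact: nb.
- apply: nb; first by apply: closed_openC; exact: closed_closure.
  by move=> s Sqs /Uq; exact.
have [] := e2 (rep e); first exact: icer_refl.
by apply: subset_closure; apply: OU; apply: e1; exact: icer_refl.
Qed.

Definition qt_act t (c : qt) : qt := cls (dact t (rep c)).

Lemma qt_act_cls t p : qt_act t (cls p) = cls (dact t p).
Proof.
apply/cls_eq; apply: (icer_act hS); apply: (icer_sym hS); exact: rep_cls.
Qed.

Lemma qt_act1 c : qt_act (mone T) c = c.
Proof. by rewrite -(repK c) qt_act_cls dact1. Qed.

Lemma qt_actM s t c : qt_act (mmul s t) c = qt_act s (qt_act t c).
Proof. by rewrite -(repK c) !qt_act_cls dactM. Qed.

Lemma qt_act_cont t : continuous (qt_act t).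
Proof.
apply: qt_continuous; rewrite (_ : _ \o _ = cls \o dact t).
  by apply: continuous_comp'; [exact: dact_cont|exact: cls_continuous].
by apply/funext => p /=; exact: qt_act_cls.
Qed.

Definition qdyn : cdyn T :=
  @CDyn T (Dynamic qt_act1 qt_actM qt_act_cont) qt_compact qt_haus.

End Quotient.

Definition dyn_minimal (T : monoid) (Z : dynamic T) :=
  minimal_set (@dact T Z) [set: Z].

Lemma minimal_image (T : monoid) (Y Z : dynamic T) (f : Y -> Z) :
  continuous f -> (forall t y, f (dact t y) = dact t (f y)) ->
  (forall z, exists y, f y = z) -> dyn_minimal Y -> dyn_minimal Z.
Proof.
move=> cf ef sf [[y0 _] minY]; split; first by exists (f y0).
move=> B _ [z Bz] cB iB.
have E : f @^-1` B = setT.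
  apply: minY => //; first by have [y fy] := sf z; exists y; rewrite /= fy.
    exact: closed_preim cB.
  by move=> t y /= By; rewrite ef; exact: iB.
rewrite eqEsubset; split=> // w _; have [y <-] := sf w.
by have : setT y by []; rewrite -E.
Qed.

(* The universal minimal flow, realised as a minimal left ideal [uj @` setT]
   of the Stone-Cech compactification of [T]. *)
Record umin (T : monoid) := UMin {
  um :> cdyn T;
  uj : um -> bT T;
  uj_continuous : continuous (uj : um -> bT_dyn T);
  uj_act : forall t p, uj (dact t p) = bT_act t (uj p);
  uj_inj : injective uj;
  um_minimal : dyn_minimal um }.

(** The minimal left ideal is obtained not as a subspace but as the quotient of the ultrafilter flow
    by the kernel of right multiplication by one of its elements [u], so that compactness and
    separation come from [qdyn]. *)
Lemma umin_exists (T : monoid) : exists M : umin T, True.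
Proof.
have [|B [[u Bu] cB iB _ Bmin]] := @min_inv _ (@cdyn_compact _ (bT_dyn T)) T
   (@dact _ (bT_dyn T)) setT _ closedT (fun _ _ _ => I).
  by exists (bpr (mone T)).
pose f (xi : bT_dyn T) : bT_dyn T := uact xi u.
have cf : continuous f by exact: uact_continuous.
have fact t xi : f (dact t xi) = dact t (f xi) by rewrite /f -uact_act.
have hS : @is_icer T (bT_dyn T) [set w | f w.1 = f w.2].
  split=> //=.
  - apply: (@closed_equalizer _ _ (f \o fst) (f \o snd)) => //.
      apply: continuous_comp' cf; exact: fst_continuous.
    apply: continuous_comp' cf; exact: snd_continuous.
  - by move=> p q r -> ->.
  - by move=> t p q; rewrite !fact => ->.
pose M := qdyn hS.
pose j (c : M) := f (rep c).
have jcls xi : j (cls _ xi) = f xi.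
  by apply/esym; exact: (rep_cls hS xi).
have jact t (p : M) : j (dact t p) = dact t (j p).
  by rewrite -(repK p) /= (qt_act_cls hS) !jcls fact.
have cj : continuous j.
  apply: qt_continuous; rewrite (_ : _ \o _ = f) //.
  by apply/funext => xi /=; exact: jcls.
have jinj : injective j.
  move=> c d; rewrite -(repK c) -(repK d) !jcls => E.
  exact/(cls_eq hS).
have fB xi : B (f xi) by exact: uact_inv.
have jB c : B (j c) by exact: fB.
have minM : dyn_minimal M.
  split; first by exists (cls _ u).
  move=> D _ D0 cD iD; rewrite eqEsubset; split=> // c _.
  have jDB : j @` D = B.
    apply: Bmin.
    - by have [d Dd] := D0; exists (j d); exists d.
    - exact: closed_image cj cD.
    - by move=> t _ [d Dd <-]; exists (dact t d); [exact: iD|rewrite jact].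
    - by move=> _ [d Dd <-].
  by have := jB c; rewrite -jDB => -[d Dd /jinj <-].
by exists (@UMin T M j cj jact jinj minM).
Qed.

(** * The minimal ideal *)

Section MinimalIdeal.
Variables (T : monoid) (M : umin T).

Definition ma (Z : cdyn T) (p : M) (z : Z) : Z := uact (uj p) z.
Local Notation "p ** z" := (ma p z) (at level 40, left associativity).

Definition idem (e : M) := e ** e = e.

Lemma uj_ma (p q : M) : uj (p ** q) = bmul (uj p) (uj q).
Proof.
rewrite -uact_bT; apply: (@uact_morph T M (bT_dyn T)); first exact: uj_continuous.
by move=> t y; rewrite uj_act.
Qed.

Lemma maA (Z : cdyn T) (p q : M) (z : Z) : p ** (q ** z) = p ** q ** z.
Proof. by rewrite /ma -uact_bmul -uj_ma. Qed.

Lemma ma_continuous (Z : cdyn T) (z : Z) : continuous (fun p => p ** z).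
Proof.
apply: (@continuous_comp' _ (bT_dyn T) _ (@uj _ M) (fun xi => uact xi z)).
  exact: uj_continuous.
exact: uact_continuous.
Qed.

Lemma dact_ma (Z : cdyn T) t (p : M) (z : Z) : dact t (p ** z) = dact t p ** z.
Proof. by rewrite /ma uj_act uact_act. Qed.

(** [M] being a left ideal, a limit along an ultrafilter outside [M] is absorbed into an element of
    [M]. *)
Lemma uact_ma (Z : cdyn T) xi (p : M) (z : Z) : uact xi (p ** z) = uact xi p ** z.
Proof.
apply/esym/(@uact_morph T M Z (fun p => p ** z)); first exact: ma_continuous.
by move=> t y; rewrite dact_ma.
Qed.

Lemma ma_inv (Z : cdyn T) (A : set Z) (p : M) z : closed A ->
  (forall t y, A y -> A (dact t y)) -> A z -> A (p ** z).
Proof. exact: uact_inv. Qed.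

Lemma ma_morph (Y Z : cdyn T) (f : Y -> Z) (p : M) y :
  continuous f -> (forall t y, f (dact t y) = dact t (f y)) ->
  f (p ** y) = p ** f y.
Proof. exact: uact_morph. Qed.

Lemma ma_pair (Y Z : cdyn T) (p : M) (y : Y) (z : Z) :
  @ma (prod_cdyn Y Z) p (y, z) = (p ** y, p ** z).
Proof. exact: uact_prod. Qed.

Definition morb (Z : cdyn T) (z : Z) : set Z := [set w | exists p : M, p ** z = w].

Lemma morb_closed (Z : cdyn T) (z : Z) : closed (morb z).
Proof.
have -> : morb z = (fun p => p ** z) @` setT.
  by rewrite eqEsubset; split=> [w [p <-]|w [p _ <-]]; exists p.
exact: closed_image (@cdyn_compact _ M) (@cdyn_haus _ Z) (@ma_continuous _ z) closedT.
Qed.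

Lemma morb_act (Z : cdyn T) (z : Z) t w : morb z w -> morb z (dact t w).
Proof. by move=> [p <-]; exists (dact t p); rewrite dact_ma. Qed.

Lemma um_point : exists p : M, True.
Proof. by have [[p _] _] := um_minimal M; exists p. Qed.

Lemma morb_minimal (Z : cdyn T) (z : Z) : minimal_set (@dact T Z) (morb z).
Proof.
split; first by have [p _] := um_point; exists (p ** z), p.
move=> B Bz [b Bb] cB iB; rewrite eqEsubset; split=> // _ [p <-].
have [_ minM] := um_minimal M.
have E : [set q : M | B (q ** z)] = setT.
  apply: minM => //.
  - by have [q qz] := Bz _ Bb; exists q; rewrite /= qz.
  - exact: closed_preim (@ma_continuous _ z) cB.
  - by move=> t q /= Bq; rewrite -dact_ma; exact: iB.
by have : setT p by []; rewrite -E.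
Qed.

Lemma minimal_morb (Z : cdyn T) (A : set Z) z w : minimal_set (@dact T Z) A ->
  closed A -> (forall t y, A y -> A (dact t y)) -> A z -> A w -> morb z w.
Proof.
move=> [_ minA] cA iA Az Aw.
suff -> : morb z = A by [].
apply: minA.
- by move=> _ [p <-]; exact: ma_inv.
- by have [p _] := um_point; exists (p ** z), p.
- exact: morb_closed.
- by move=> t y; exact: morb_act.
Qed.

Lemma dyn_minimal_morb (Z : cdyn T) (z w : Z) : dyn_minimal Z -> morb z w.
Proof. by move=> mZ; apply: (minimal_morb mZ) => //; exact: closedT. Qed.

Lemma um_morb (p q : M) : morb p q.
Proof. by apply: dyn_minimal_morb; exact: um_minimal. Qed.

Lemma ma_idem (e p : M) : idem e -> p ** e = p.
Proof. by move=> ee; have [q <-] := um_morb e p; rewrite -maA ee. Qed.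

(* Ellis: a minimal closed subsemigroup [B] satisfies [B b = B] for [b] in [B],
   hence also [{p in B | p b = b} = B]. *)
Lemma idem_exists (A : set M) : A !=set0 -> closed A ->
  (forall p q, A p -> A q -> A (p ** q)) -> exists2 e, A e & idem e.
Proof.
move=> A0 cA sA.
have [||B [[B0 cB sB] BA Bmin]] := @zorn_min M
   (fun B => [/\ B !=set0, closed B & forall p q : M, B p -> B q -> B (p ** q)]) A.
- by split.
- move=> C C0 CP Ctot; split.
  + by apply: chain_cap => // B /CP[].
  + by apply: closed_bigI => B /CP[].
  + move=> p q Cp Cq B CB; have [_ _ sB] := CP _ CB.
    by apply: sB; [exact: Cp|exact: Cq].
have [b Bb] := B0; exists b; first exact: BA.
have E : (fun p => p ** b) @` B = B.
  apply: Bmin; last by move=> _ [p Bp <-]; exact: sB.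
  split.
  - by exists (b ** b), b.
  - exact: closed_image (@cdyn_compact _ M) (@cdyn_haus _ M) (@ma_continuous _ b) cB.
  - move=> _ _ [p Bp <-] [q Bq <-]; exists (p ** b ** q); last by rewrite maA.
    exact: (sB _ _ (sB _ _ Bp Bb) Bq).
have E2 : B `&` [set p | p ** b = b] = B.
  apply: Bmin; last by move=> p [].
  split.
  - have [p Bp pb] : ((fun p => p ** b) @` B) b by rewrite E.
    by exists p.
  - apply: closedI => //; apply: closed_equalizer; first exact: cdyn_haus.
      exact: ma_continuous.
    by move=> p; exact: cvg_cst.
  - by move=> p q [Bp pb] [Bq qb]; split; [exact: sB|rewrite /= -maA qb].
by have [] : (B `&` [set p | p ** b = b]) b by rewrite E2.
Qed.

Lemma fix_idem (Z : cdyn T) (z : Z) : morb z z ->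
  exists2 e : M, idem e & e ** z = z.
Proof.
move=> [p pz].
have [|||e ez ee] := @idem_exists [set q | q ** z = z]; last by exists e.
- by exists p.
- apply: closed_equalizer; [exact: cdyn_haus|exact: ma_continuous|].
  by move=> q; exact: cvg_cst.
- by move=> q r /= qz rz; rewrite -maA rz.
Qed.

Lemma minimal_idem (Z : cdyn T) (A : set Z) z : minimal_set (@dact T Z) A ->
  closed A -> (forall t y, A y -> A (dact t y)) -> A z ->
  exists2 e : M, idem e & e ** z = z.
Proof. by move=> mA cA iA Az; apply: fix_idem; exact: (minimal_morb mA). Qed.

(** If [z] is a.p., finitely many preimages of a closed neighborhood of [z] cover its orbit, hence
    contain [m ** z]; so [z] is in the orbit closure of [m ** z] and is fixed by an element of [M].
    Conversely, compactness of [M] supplies the finite set of syndeticity. *)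
Lemma ap_fix (Z : cdyn T) (z : Z) :
  ap_point (@dact T Z) z <-> exists2 e : M, idem e & e ** z = z.
Proof.
split=> [apz|[e ee ez] U zU].
  apply: fix_idem; have [m _] := um_point.
  suff [xi E] : exists xi, z = uact xi (m ** z).
    by exists (uact xi m); rewrite -uact_ma -E.
  apply/orbit_closure => V /cdyn_regular[W [/apz[K [fK KW]] cW WV]].
  have : (\bigcup_(k in K) [set y | W (dact k y)]) (m ** z).
    apply: uact_closed; first by apply: (@closed_bigcup Z {classic T}) => // k _; exact: dact_closed.
    apply: btS (btT _) => t _; have [k [Kk kt]] := KW t.
    by exists k => //=; rewrite -dactM.
  move=> [k Kk /WV kV]; exists (dact k (m ** z)); split=> //; by exists k.
pose O t := [set p : M | U^° (dact t p ** z)].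
have oO t : open (O t).
  have /continuousP := @ma_continuous Z z.
  move=> /(_ _ (open_interior U)) oU.
  by have /continuousP/(_ _ oU) := @dact_cont _ M t.
have [K fK KO] : exists2 K : set T, finite_set K & forall p, exists2 k, K k & O k p.
  apply: contrapT => noK.
  have [||A|F [UF BF]] := @ultra_ext M
     (fun A => exists2 K : set T, finite_set K & A = ~` \bigcup_(k in K) O k).
  - by exists set0 => //; rewrite bigcup_set0 setC0.
  - move=> _ _ [K fK ->] [L fL ->]; exists (~` \bigcup_(k in K `|` L) O k); split.
      by exists (K `|` L) => //; rewrite finite_setU.
    by rewrite bigcup_setU setCU.
  - move=> [K fK ->]; apply: contrapT => nA; apply: noK; exists K => // p.
    by apply: contrapT => np; apply: nA; exists p => -[k Kk Op]; apply: np; exists k.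
  have [p pF] := ultra_lim id (@cdyn_compact _ M) UF.
  (* By minimality of [M] some [q] sends [p] to [e], so the orbit of [p ** z] comes near
     [e ** z = z]. *)
  have [t tp] : exists t, O t p.
    have [xi E] : exists xi, z = uact xi (p ** z).
      have [q qp] := um_morb p e; exists (uj q).
      by rewrite -/(ma q (p ** z)) maA qp ez.
    have zU' : nbhs (uact xi (p ** z)) U^° by rewrite -E; exact: nbhs_interior.
    have [t tU] := bt_ex (uactP zU'); exists t.
    by rewrite /O /= -dact_ma.
  have FO : F (O t) by exact: (pF _ (open_nbhs_nbhs (conj (oO t) tp))).
  apply: (ultra_notC UF FO); apply: BF; exists [set t]; first exact: finite_set1.
  by rewrite bigcup_set1.
exists K; split=> // t; have [k Kk kt] := KO (dact t e).
exists k; split=> //; apply: interior_subset.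
by rewrite /= -{1}ez dact_ma dactM.
Qed.

(** * The group of elements of [M] fixed by an idempotent on the left *)

Section Group.
Variable u : M.
Hypothesis hu : idem u.

Definition ellis_group : set M := [set p | u ** p = p].

Local Notation G := ellis_group.

Definition ginv (p : M) : M :=
  xget u [set q | [/\ G q, q ** p = u & p ** q = u]].

Lemma Gu : G u. Proof. exact: hu. Qed.

Lemma ma_u (p : M) : p ** u = p. Proof. exact: ma_idem. Qed.

Lemma G_ma p q : G p -> G (p ** q).
Proof. by rewrite /G /= maA => ->. Qed.

Lemma G_u q : G (u ** q).
Proof. by apply: G_ma; exact: Gu. Qed.

(** Minimality gives a left inverse [q]. Then [p ** q] is idempotent, and as every idempotent is a
    right identity of [M], multiplying it by [u] on the left gives [u]. *)
Lemma ginv_spec p : G p -> [/\ G (ginv p), ginv p ** p = u & p ** ginv p = u].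
Proof.
move=> Gp; rewrite /ginv; case: xgetP => [y _ //|nog].
have [r rp] := um_morb p u.
case: (nog (u ** r)).
have qp : u ** r ** p = u by rewrite -maA rp.
split=> //; first exact: G_u.
have pq : idem (p ** (u ** r)).
  by rewrite /idem maA -(maA p (u ** r) p) qp ma_u.
have := ma_idem u pq; rewrite maA Gp; exact.
Qed.

Lemma G_ginv p : G p -> G (ginv p). Proof. by move=> /ginv_spec[]. Qed.
Lemma ginvl p : G p -> ginv p ** p = u. Proof. by move=> /ginv_spec[]. Qed.
Lemma ginvr p : G p -> p ** ginv p = u. Proof. by move=> /ginv_spec[]. Qed.

Lemma ginv_uniq p q : G p -> G q -> q ** p = u -> q = ginv p.
Proof.
by move=> Gp Gq qp; rewrite -(ma_u q) -(ginvr Gp) maA qp G_ginv.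
Qed.

Lemma ginvK p : G p -> ginv (ginv p) = p.
Proof. by move=> Gp; apply/esym/ginv_uniq => //; [exact: G_ginv|exact: ginvr]. Qed.

Lemma ginvM p q : G p -> G q -> ginv (p ** q) = ginv q ** ginv p.
Proof.
move=> Gp Gq; apply/esym/ginv_uniq; first exact: G_ma.
  by apply: G_ma; exact: G_ginv.
by rewrite -maA (maA (ginv p)) ginvl // Gq ginvl.
Qed.

Lemma ginv_u : ginv u = u.
Proof. by apply/esym/ginv_uniq => //; exact: Gu. Qed.

Lemma Gmulr p q : G q -> p ** q ** ginv q = p.
Proof. by move=> Gq; rewrite -maA ginvr // ma_u. Qed.

Lemma GmulrV p q : G q -> p ** ginv q ** q = p.
Proof. by move=> Gq; rewrite -maA ginvl // ma_u. Qed.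

Lemma Gmull p q : G p -> G q -> ginv p ** (p ** q) = q.
Proof. by move=> Gp Gq; rewrite maA ginvl. Qed.

Lemma GmullV p q : G p -> G q -> p ** (ginv p ** q) = q.
Proof. by move=> Gp Gq; rewrite maA ginvr. Qed.

End Group.
End MinimalIdeal.

(** * The circle operation and the tau-topology *)

Section Circle.
Variables (T : monoid) (M : umin T).
Local Notation "p ** z" := (@ma T M _ p z) (at level 40, left associativity).

Definition co (Z : cdyn T) (p : M) (A : set Z) : set Z := circ (uj p) A.

Lemma co_co (Z : cdyn T) (p q : M) (A : set Z) : co p (co q A) = co (p ** q) A.
Proof. by rewrite /co circ_bmul uj_ma. Qed.

Lemma coS (Z : cdyn T) (p : M) (A B : set Z) : A `<=` B -> co p A `<=` co p B.
Proof. exact: circS. Qed.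

Lemma co_ma (Z : cdyn T) (p : M) (A : set Z) a : A a -> co p A (p ** a).
Proof. exact: circ_uact. Qed.

Lemma co_closure (Z : cdyn T) (p : M) (A : set Z) a : closure A a -> co p A (p ** a).
Proof. exact: circ_closure. Qed.

Lemma co_dact (Z : cdyn T) (p : M) (A : set Z) t z :
  co p A z -> co (dact t p) A (dact t z).
Proof. by move=> zA; rewrite /co uj_act; exact: circ_dact. Qed.

Lemma co_rmul (p : M) (A : set M) (q z : M) : co p A z ->
  co p ((fun a => a ** q) @` A) (z ** q).
Proof.
apply: (@circ_morph T M M (fun a => a ** q)); first exact: ma_continuous.
by move=> t y; rewrite dact_ma.
Qed.

Lemma uj_nbhs (p : M) P : sval (uj p) P -> nbhs p [set q : M | sval (uj q) P].
Proof.
move=> pP; have h : nbhs (uj p : bT_dyn T) [set xi : bT T | sval xi P].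
  by apply/bT_nbhsP; exists P.
exact: (@uj_continuous _ M p _ h).
Qed.

Lemma co_closed_rel (Z : cdyn T) (A : set Z) :
  closed [set w : M * Z | co w.1 A w.2].
Proof.
move=> [p z] cl; apply: contrapT => /circ_closed_rel[P [V [pP zV nA]]].
have [|[q y] [/= yA [qP yV]]] := cl ([set q : M | sval (uj q) P] `*` V).
  by exists ([set q : M | sval (uj q) P], V) => //; split=> //; exact: uj_nbhs.
exact: (nA (uj q) y).
Qed.

Section Tau.
Variable u : M.
Hypothesis hu : idem u.
Local Notation G := (ellis_group u).
Local Notation inv := (ginv u).

(* The closure operator of Ellis' tau-topology on the group [G]; it is T1, compact,
   and translations and inversion are continuous, but it is in general not
   Hausdorff. *)
Definition tau_cl (B : set M) : set M := [set a | G a /\ co u B a].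
Local Notation cl := tau_cl.

Lemma clS A B : A `<=` B -> cl A `<=` cl B.
Proof. by move=> AB a [Ga Aa]; split=> //; exact: coS Aa. Qed.

Lemma cl_mono A B a : cl A a -> A `<=` B -> cl B a.
Proof. by move=> Aa AB; exact: clS Aa. Qed.

Lemma cl_G B : cl B `<=` G. Proof. by move=> a []. Qed.

Lemma cl_sub B : B `<=` G -> B `<=` cl B.
Proof.
move=> BG b Bb; have Gb := BG _ Bb; split=> //.
by rewrite -Gb; exact: co_ma.
Qed.

Lemma clU A B : cl (A `|` B) `<=` cl A `|` cl B.
Proof. by move=> a [Ga /circU[]]; [left|right]. Qed.

Lemma cl_cl B : cl (cl B) `<=` cl B.
Proof.
move=> a [Ga aB]; split=> //; rewrite -[u]hu -co_co.
by apply: coS aB => b [].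
Qed.

(** The bridge from the topology of [M] to the tau-topology: ordinary limits, multiplied by [u], are
    tau-limits. *)
Lemma closure_cl (B : set M) (m : M) : closure B m -> cl B (u ** m).
Proof. by move=> Bm; split; [exact: G_u|exact: co_closure]. Qed.

Lemma cl_rmul (B : set M) (b g : M) : cl B b -> cl ((fun a => a ** g) @` B) (b ** g).
Proof. by move=> [Gb bB]; split; [exact: G_ma|exact: co_rmul]. Qed.

Lemma cl_co (k : M) (B : set M) (b : M) : G k -> co k B b -> cl B (inv k ** b).
Proof.
move=> Gk kB; split; first by apply: G_ma; exact: G_ginv.
by rewrite -{1}(ginvl hu Gk) -co_co; exact: co_ma.
Qed.

(** It suffices that [u] be in the circle product of [b] with the inverses. If a neighborhood [V] of
    [u] refutes this, it does so on a neighborhood of [b], which contains some [dact t b'] with [b']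
    in [B] and [dact t u] in [V]. But [dact t u] is [dact t b' ** inv b'], a contradiction. *)
Lemma cl_inv B b : B `<=` G -> cl B b -> cl (inv @` B) (inv b).
Proof.
move=> BG [Gb bB]; rewrite -(ma_u hu (inv b)); apply: cl_co => // V uV.
apply: contrapT => /btN/uj_nbhs bO.
have uV' : nbhs (u ** u) V^° by rewrite hu; exact: nbhs_interior.
have [t [[b' Bb' b'O] tuV]] := bt_exI (bB _ bO) (uactP uV').
have Gb' := BG _ Bb'.
have /uactP bV : nbhs (dact t b' ** inv b') V by rewrite -dact_ma ginvr.
have [s [sn sV]] := bt_exI b'O bV.
by apply: sn; exists (inv b') => //; exists b'.
Qed.

(** Left multiplication in [M] need not be continuous; on [G] it is right multiplication conjugated
    by inversion. *)
Lemma cl_lmul (B : set M) (b g : M) : B `<=` G -> G g -> cl B b ->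
  cl ((fun a => g ** a) @` B) (g ** b).
Proof.
move=> BG Gg clb; have Gb := cl_G clb.
have iBG : inv @` B `<=` G by move=> _ [a /BG Ga <-]; exact: G_ginv.
have iM a : G a -> inv (inv a ** inv g) = g ** a.
  by move=> Ga; rewrite (ginvM hu) ?(ginvK hu) //; exact: G_ginv.
rewrite -(iM _ Gb).
apply: clS (cl_inv _ (@cl_rmul _ _ (inv g) (cl_inv BG clb))).
  by move=> _ [_ [_ [a Ba <-] <-] <-]; exists a => //; rewrite iM //; exact: BG.
by move=> _ [a /iBG Ga <-]; exact: G_ma.
Qed.

Lemma tau_compact (B : set M) (F : set (set M)) : cl B `<=` B ->
  F !=set0 -> (forall A C, F A -> F C -> exists2 D, F D & D `<=` A `&` C) ->
  (forall A, F A -> B `&` A !=set0) ->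
  exists2 a, B a & forall A, F A -> cl A a.
Proof.
move=> cB [A0 FA0] FI FB.
have [||A|U [UU BU]] := @ultra_ext M
    (fun A => A = setT \/ exists2 C, F C & A = B `&` C); first by left.
- move=> A C [->|[A' FA' ->]] [->|[C' FC' ->]].
  + by exists setT; split=> //; left.
  + by exists (B `&` C'); split; [right; exists C'|move=> m mC].
  + by exists (B `&` A'); split; [right; exists A'|move=> m mC].
  + have [D FD DAC] := FI _ _ FA' FC'; exists (B `&` D); split; first by right; exists D.
    by move=> m [Bm /DAC[]].
- move=> [->|[C FC ->]]; last exact: FB.
  by have [b _] := FB _ FA0; exists b.
have [m mU] := ultra_lim id (@cdyn_compact _ M) UU.
have clm C : F C -> closure (B `&` C) m.
  move=> FC V /mU UV.
  have UBC : U (B `&` C) by apply: BU; right; exists C.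
  exact: (filter_ex (filterI UBC UV)).
exists (u ** m).
  apply: cB; apply: closure_cl; apply: closure_subset (clm _ FA0); exact: subIsetl.
move=> A FA; apply: closure_cl; apply: closure_subset (clm _ FA); exact: subIsetr.
Qed.

End Tau.
End Circle.

(** * The derived group of an Ellis group *)

Section TauGroups.
Variables (T : monoid) (M : umin T) (u : M).
Hypothesis hu : idem u.
Local Notation "p ** z" := (@ma T M _ p z) (at level 40, left associativity).
Local Notation G := (ellis_group u).
Local Notation inv := (ginv u).
Local Notation cl := (tau_cl u).

Definition lset (g : M) (B : set M) : set M := (fun a => g ** a) @` B.
Definition rset (B : set M) (g : M) : set M := (fun a => a ** g) @` B.

Record is_group (F : set M) : Prop := IsGroup {
  group_G : F `<=` G;
  group_u : F u;
  group_mul : forall a b, F a -> F b -> F (a ** b);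
  group_inv : forall a, F a -> F (inv a) }.

(** Translations are only separately continuous, so products are closed up one factor at a time. *)
Lemma cl_group K : is_group K -> is_group (cl K).
Proof.
move=> gK; have KG := group_G gK.
have clmul k b : K k -> cl K b -> cl K (k ** b).
  move=> Kk Kb; apply: (cl_mono (cl_lmul hu KG (KG _ Kk) Kb)) => _ [a Ka <-].
  exact: group_mul.
split.
- exact: cl_G.
- exact: (cl_sub KG (group_u gK)).
- move=> a b Ka Kb; apply: (@cl_cl _ _ _ hu K); apply: (cl_mono (cl_rmul b Ka)) => _ [k Kk <-].
  exact: clmul.
- move=> a Ka; apply: (cl_mono (cl_inv hu KG Ka)) => _ [k Kk <-].
  exact: group_inv.
Qed.

Variable F : set M.
Hypothesis gF : is_group F.
Hypothesis Fcl : cl F `<=` F.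
Let FG := group_G gF.
Let FM := group_mul gF.
Let FV := group_inv gF.
Let Fu := group_u gF.

Let FNG N : F `\` N `<=` G.
Proof. by move=> b [/FG]. Qed.

(* [N] is a neighborhood of [a] in [F] for the tau-topology. *)
Definition nb (N : set M) (a : M) := N `<=` F /\ ~ cl (F `\` N) a.

Lemma nb_self N a : F a -> nb N a -> N a.
Proof.
move=> Fa [_ na]; apply: contrapT => nN; apply: na.
by apply: (cl_sub (@FNG N)).
Qed.

Lemma nb_F N a : N `<=` F -> F `<=` N -> F a -> nb N a.
Proof.
move=> NF FN Fa; split=> // -[_ /(_ setT filterT)/bt_ex[t [b [Fb nN]]]].
by case: nN; exact: FN.
Qed.

Lemma nb_lmul g N a : F g -> F a -> nb N a -> nb (lset g N) (g ** a).
Proof.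
move=> Fg Fa [NF na]; split; first by move=> _ [b /NF Fb <-]; exact: FM.
move=> H; apply: na; rewrite -(Gmull hu (FG Fg) (FG Fa)).
apply: (cl_mono (cl_lmul hu (@FNG _) (G_ginv hu (FG Fg)) H)) => _ [b [Fb nb] <-]; split; first by apply: FM => //; exact: FV.
by move=> Nb; apply: nb; exists (inv g ** b) => //; rewrite (GmullV hu (FG Fg) (FG Fb)).
Qed.

Lemma nb_rmul g N a : F g -> F a -> nb N a -> nb (rset N g) (a ** g).
Proof.
move=> Fg Fa [NF na]; split; first by move=> _ [b /NF Fb <-]; exact: FM.
move=> H; apply: na; rewrite -(Gmulr hu a (FG Fg)).
apply: (cl_mono (cl_rmul (inv g) H)) => _ [b [Fb nb] <-].
split; first by apply: FM => //; exact: FV.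
by move=> Nb; apply: nb; exists (b ** inv g) => //; rewrite (GmulrV hu b (FG Fg)).
Qed.

Lemma nb_inv N a : F a -> nb N a -> nb (inv @` N) (inv a).
Proof.
move=> Fa [NF na]; split; first by move=> _ [b /NF Fb <-]; exact: FV.
move=> H; apply: na; rewrite -(ginvK hu (FG Fa)).
apply: (cl_mono (cl_inv hu (@FNG _) H)) => _ [b [Fb nb] <-]; split; first exact: FV.
by move=> Nb; apply: nb; exists (inv b) => //; rewrite (ginvK hu (FG Fb)).
Qed.

Lemma nb_open N a : F a -> nb N a -> exists O,
  [/\ O a, O `<=` N & forall b, O b -> nb O b].
Proof.
move=> Fa [NF na]; exists (F `\` cl (F `\` N)); split=> //.
  move=> b [Fb nb]; apply: contrapT => nN; apply: nb.
  by apply: (cl_sub (@FNG N)).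
move=> b [Fb nb]; split; first by move=> c [].
move=> H; apply: nb; apply: (@cl_cl _ _ _ hu (F `\` N)); apply: (cl_mono H) => c [Fc].
by move=> nc; apply: contrapT => ncl; apply: nc.
Qed.

Lemma cl_nb A N a : A `<=` F -> cl A a -> nb N a -> exists2 b, A b & N b.
Proof.
move=> AF Aa [NF na]; apply: contrapT => nAN; apply: na; apply: (cl_mono Aa) => b Ab.
by split; [exact: AF|move=> Nb; apply: nAN; exists b].
Qed.

Lemma nb_cl A a : F a -> A `<=` F ->
  (forall N, N a -> (forall b, N b -> nb N b) -> exists2 b, A b & N b) -> cl A a.
Proof.
move=> Fa AF H; apply: contrapT => nA.
have nbA : nb (F `\` A) a.
  split; first by move=> b [].
  by rewrite setDD => HA; apply: nA; apply: (cl_mono HA) => b [].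
have [O [Oa OA Oo]] := nb_open Fa nbA.
by have [b Ab /OA[]] := H O Oa Oo.
Qed.

(* The intersection of the closed neighborhoods of [u]; the quotient of [F] by it
   is its largest Hausdorff quotient group. *)
Definition derived : set M := [set h | F h /\ forall N, nb N u -> cl N h].

Lemma H_mul a b : derived a -> derived b -> derived (a ** b).
Proof.
move=> [Fa Ha] [Fb Hb]; split; first exact: FM.
move=> N0 N0u; have [N [Nu NN0 No]] := nb_open Fu N0u.
apply: (clS NN0); have NF : N `<=` F by have [] := No _ Nu.
apply: nb_cl => //; first exact: FM.
move=> W Wab Wo; have WF : W `<=` F by have [] := Wo _ Wab.
have W1 : nb (rset W (inv b)) a.
  rewrite -(Gmulr hu a (FG Fb)); apply: nb_rmul; [exact: FV|exact: FM|exact: Wo].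
have [n Nn [w Ww wn]] := cl_nb NF (Ha _ (No _ Nu)) W1.
have Fn := NF _ Nn.
have nbW : W (n ** b) by rewrite -wn (GmulrV hu w (FG Fb)).
have W2 : nb (lset (inv n) W) b.
  rewrite -(Gmull hu (FG Fn) (FG Fb)).
  by apply: nb_lmul; [exact: FV|exact: FM|exact: Wo].
have N2 : nb (lset (inv n) N) u.
  by have := nb_lmul (FV Fn) Fn (No _ Nn); rewrite (ginvl hu (FG Fn)).
have [NF2 _] := N2.
have [_ [x Nx <-] [y Wy E]] := cl_nb NF2 (Hb _ N2) W2.
exists x => //; rewrite -(GmullV hu (FG Fn) (FG (NF _ Nx))) -E.
by rewrite (GmullV hu (FG Fn) (FG (WF _ Wy))).
Qed.

Lemma H_inv a : derived a -> derived (inv a).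
Proof.
move=> [Fa Ha]; split; first exact: FV.
move=> N Nu; have NF : N `<=` F by case: Nu.
have := nb_inv Fu Nu; rewrite (ginv_u hu) => /Ha H1.
have NG : inv @` N `<=` G by move=> _ [b /NF/FG Gb <-]; exact: G_ginv.
apply: (cl_mono (cl_inv hu NG H1)).
by move=> _ [_ [b Nb <-] <-]; rewrite (ginvK hu (FG (NF _ Nb))).
Qed.

Lemma H_conj g h : F g -> derived h -> derived (inv g ** h ** g).
Proof.
move=> Fg [Fh Hh]; split; first by apply: FM => //; apply: FM => //; exact: FV.
move=> N Nu; have NF : N `<=` F by case: Nu.
have N1 : nb (rset (lset g N) (inv g)) u.
  have := nb_lmul Fg Fu Nu; rewrite (ma_u hu) => /(nb_rmul (FV Fg) Fg).
  by rewrite (ginvr hu (FG Fg)).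
have H1 := Hh _ N1; have [N1F _] := N1.
have N1G := subset_trans N1F FG.
apply: (cl_mono (cl_rmul g (cl_lmul hu N1G (G_ginv hu (FG Fg)) H1))).
move=> _ [_ [_ [_ [b Nb <-] <-] <-] <-].
by rewrite (maA (inv g)) (Gmull hu (FG Fg) (FG (NF _ Nb))) (GmulrV hu b (FG Fg)).
Qed.

Lemma H_group : is_group derived.
Proof.
split.
- by move=> h [/FG].
- split=> // N Nu; apply: cl_sub; last exact: nb_self Nu.
  by case: Nu => NF _ b /NF/FG.
- exact: H_mul.
- exact: H_inv.
Qed.

Definition HA (A : set M) : set M := [set g | exists h a, [/\ derived h, A a & g = h ** a]].

(** The derived group is normal, by [H_conj], so its elements can be moved past those of [A]. *)
Lemma HA_group A : is_group A -> A `<=` F -> is_group (HA A).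
Proof.
move=> gA AF; have gH := H_group; have AG := group_G gA; have HG := group_G gH.
have swap a h : A a -> derived h -> exists2 h', derived h' & a ** h = h' ** a.
  move=> Aa Hh; exists (a ** h ** inv a).
    have := H_conj (FV (AF _ Aa)) Hh; rewrite (ginvK hu (AG _ Aa)) //.
  by rewrite (GmulrV hu _ (AG _ Aa)).
split.
- by move=> _ [h [a [/HG Gh _ ->]]]; exact: G_ma.
- by exists u, u; split; [exact: group_u|exact: group_u|rewrite hu].
- move=> _ _ [h [a [Hh Aa ->]]] [h' [a' [Hh' Aa' ->]]].
  have [h2 Hh2 E] := swap _ _ Aa Hh'.
  exists (h ** h2), (a ** a'); split; [exact: H_mul|exact: group_mul|].
  by rewrite maA -(maA h a) E !maA.
- move=> _ [h [a [Hh Aa ->]]].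
  have [h2 Hh2 E] := swap _ _ (group_inv gA Aa) (H_inv Hh).
  exists h2, (inv a); split=> //; first exact: group_inv.
  by rewrite (ginvM hu) //; [exact: HG|exact: AG].
Qed.

End TauGroups.

(** * Invariant closed equivalence relations *)

Section Icers.
Variables (T : monoid) (M : umin T) (u : M).
Hypothesis hu : idem u.
Local Notation "p ** z" := (@ma T M _ p z) (at level 40, left associativity).
Local Notation G := (ellis_group u).
Local Notation inv := (ginv u).
Local Notation cl := (tau_cl u).
Implicit Types p q r a b : M.

Lemma icer_ma (S : set (M * M)) (r p q : M) : is_icer S -> S (p, q) -> S (r ** p, r ** q).
Proof.
move=> hS Spq; rewrite -ma_pair; apply: ma_inv => //; first exact: icer_closed hS.
by move=> t [x y]; exact: (icer_act hS).
Qed.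

Lemma icer_co (S : set (M * M)) (p q r : M) A : is_icer S ->
  (forall a, A a -> S (q, a)) -> co p A r -> S (p ** q, r).
Proof.
move=> hS SA pA.
apply: (@circ_inv T (prod_cdyn M M) (uj p) ([set q] `*` A) S).
- exact: icer_closed hS.
- by move=> t [x y]; exact: (icer_act hS).
- by move=> [x y] [/= -> /SA].
- by apply: circ_prod => //; exact: (@co_ma _ _ _ p [set q] q erefl).
Qed.

(* The Ellis group of the factor [M / S]. *)
Definition egroup (S : set (M * M)) : set M := [set a | G a /\ S (u, a)].

Lemma egroup_group S : is_icer S -> is_group u (egroup S).
Proof.
move=> hS; split.
- by move=> a [].
- by split; [exact: Gu|exact: (icer_refl hS)].
- move=> a b [Ga Sa] [Gb Sb]; split; first exact: G_ma.
  by have := icer_ma a hS Sb; rewrite (ma_u hu) => /(icer_trans hS Sa).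
- move=> a [Ga Sa]; split; first exact: G_ginv.
  have := icer_sym hS (icer_ma (inv a) hS Sa).
  by rewrite (ginvl hu Ga) (ma_u hu).
Qed.

Lemma egroup_cl S : is_icer S -> cl (egroup S) `<=` egroup S.
Proof.
move=> hS a [Ga aS]; split=> //.
by rewrite -{1}[u]hu; apply: icer_co aS => // b [].
Qed.

(** By [ap_fix] in the product, these are the a.p. points of the square of [M]: one idempotent
    serves both coordinates. *)
Definition ap2 (p q : M) := exists2 e : M, idem e & e ** p = p /\ e ** q = q.

Lemma ap2_egroup S p q : is_icer S -> S (p, q) -> ap2 p q ->
  exists2 a, egroup S a & q = p ** a.
Proof.
move=> hS Spq [e ee [ep eq]].
have Gp : G (u ** p) by exact: G_u.
have Gq : G (u ** q) by exact: G_u.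
exists (inv (u ** p) ** (u ** q)).
  split; first by apply: G_ma; exact: G_ginv.
  rewrite -{1}(ginvl hu Gp); apply: icer_ma => //; exact: icer_ma.
have epu : p = e ** (u ** p) by rewrite maA (ma_u hu e) ep.
rewrite {1}epu -(maA e) (GmullV hu Gp Gq) maA (ma_u hu e) //.
Qed.

(* The circle products [p o F] are the classes of an icer: the factor of [M] by it
   is the largest proximal extension, below [M], of any factor with group [F]. *)
Definition circ_rel (F : set M) : set (M * M) := [set w | co w.1 F w.2].

Section EFacts.
Variable F : set M.
Hypothesis gF : is_group u F.

Lemma E_refl p : co p F p.
Proof. by rewrite -{2}(ma_u hu p); apply: co_ma; exact: group_u gF. Qed.

Lemma co_group a : F a -> co a F = co u F.
Proof.
have sub b : F b -> co u F `<=` co b F.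
  move=> Fb; have Gb := group_G gF Fb.
  have FbF : F `<=` co b F.
    move=> f Ff; rewrite -(GmullV hu Gb (group_G gF Ff)).
    by apply: co_ma; apply: (group_mul gF) => //; exact: (group_inv gF).
  by move=> m /(coS FbF); rewrite co_co Gb.
move=> Fa; have Ga := group_G gF Fa; rewrite eqEsubset; split; last exact: sub.
have := @coS _ _ _ a _ _ (sub _ (group_inv gF Fa)).
by rewrite !co_co (ginvr hu Ga) (ma_u hu).
Qed.

(** Points [dact t a] close to [q] inherit from [q] that their circle product with [F] comes near
    [r]; by [co_group] the factor [a] can be replaced by [u]. *)
Lemma E_trans p q r : co p F q -> co q F r -> co p F r.
Proof.
move=> pq qr; rewrite -(ma_u hu p) -co_co => V /cdyn_regular[W [rW cW WV]].
have := pq _ (uj_nbhs (qr _ rW)); apply: btS => t [a Fa] /=.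
rewrite uj_act => ta.
have {}ta : sval (uj a) [set s | exists2 b, F b & W (dact (mmul t s) b)] := ta.
have [|y ya tyW] := @circ_meet _ _ (uj a) F [set y | W (dact t y)] (dact_closed cW).
  by apply: btS ta => s /= [b Fb]; rewrite dactM; exists b.
by exists y; [rewrite -(co_group Fa)|exact: WV].
Qed.

(** Same device as in [cl_inv]: [dact t u] is written as [dact t a ** inv a]. *)
Lemma E_sym p q : co p F q -> co q F p.
Proof.
move=> pq; apply: contrapT => /existsNP[V /not_implyP[pV /btN/uj_nbhs qn]].
have pV' : nbhs (p ** u) V^° by rewrite (ma_u hu); exact: nbhs_interior.
have [t [[a Fa] /=]] := bt_exI (pq _ qn) (uactP pV').
rewrite uj_act => ta tuV.
have {}ta : sval (uj a) (~` [set s | exists2 b, F b & V (dact (mmul t s) b)]) := ta.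
have Ga := group_G gF Fa.
have /uactP aV : nbhs (a ** inv a) [set y | V (dact t y)].
  by rewrite (ginvr hu Ga); exact: dact_nbhs.
have [s [sn sV]] := bt_exI ta aV.
by apply: sn; exists (inv a); [exact: (group_inv gF)|rewrite dactM].
Qed.

Lemma E_icer : is_icer (circ_rel F).
Proof.
split.
- exact: co_closed_rel.
- exact: E_refl.
- exact: E_sym.
- exact: E_trans.
- by move=> t p q; exact: co_dact.
Qed.
End EFacts.

Lemma E_sub S : is_icer S -> circ_rel (egroup S) `<=` S.
Proof.
move=> hS [p q] /= pq; rewrite -(ma_u hu p); apply: icer_co pq => // a [].
by [].
Qed.

Lemma ap2_E S p q : is_icer S -> S (p, q) -> ap2 p q -> circ_rel (egroup S) (p, q).
Proof.
by move=> hS Spq /(ap2_egroup hS Spq)[a Fa ->]; exact: co_ma.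
Qed.

(** * The cocycle modulo the derived group and the a.p. steps it defines *)

Section Limits.
Variable F : set M.
Hypothesis gF : is_group u F.
Hypothesis Fcl : cl F `<=` F.

(* [Lim p q a]: if [t_i -> p] and [t_i a_i -> q] then [a_i] accumulates at [a]
   modulo [derived u F]; hence [a] represents the value at [(p, q)] of an invariant
   cocycle with values in [F / derived u F]. *)
Definition Lim (p q a : M) := F a /\ forall N, nb u F N a -> co p N q.

(** The sets whose removal from [B] loses [q] form a filter by [circU]; any tau-cluster point of it
    in [B] is a limit value. *)
Lemma Lim_ex B p q : B `<=` F -> cl B `<=` B -> co p B q ->
  exists2 a, B a & Lim p q a.
Proof.
move=> BF clB pq.
have [|A C nA nC|A nA|a Ba aP] := @tau_compact _ _ _ hu B
    (fun C => ~ co p (B `\` C) q) clB.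
- exists B; rewrite setDv => /(_ setT filterT)/bt_ex[t [b []]].
- exists (A `&` C) => //; rewrite setDIr => /circU[]; [exact: nA|exact: nC].
- apply: contrapT => BA; apply: nA; apply: coS pq => b Bb; split=> // Ab.
  by apply: BA; exists b.
exists a => //; split; first exact: BF.
move=> N [NF nN]; apply: contrapT => npN; apply: nN; apply: aP => npB.
by apply: npN; apply: coS npB => b [/BF Fb nb]; apply: contrapT => nNb; apply: nb.
Qed.

Lemma Lim_co p q a : Lim p q a -> co p F q.
Proof. by move=> [Fa]; apply; exact: (nb_F). Qed.

(** Well-definedness of the cocycle: multiplying the defining limits on the left by [u ** w]
    computes the value inside [G], up to the closure of every neighborhood of [u]. *)
Lemma Lim_coset p q a w : Lim p q a ->
  derived u F (inv a ** (inv (u ** w ** p) ** (u ** w ** q))).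
Proof.
move=> [Fa La]; have Ga := group_G gF Fa; set k := u ** w ** p.
have Gk : G k by rewrite /k -maA; exact: G_u.
have key N : nb u F N u -> cl N (inv a ** (inv k ** (u ** w ** q))).
  move=> Nu; have [NF _] := Nu.
  have aN := nb_lmul hu gF Fa (group_u gF) Nu.
  rewrite (ma_u hu) in aN; have [aNF _] := aN.
  have := @co_ma _ _ _ (u ** w) _ _ (La _ aN); rewrite co_co => /(cl_co hu Gk) H1.
  apply: (cl_mono (cl_lmul hu (subset_trans aNF (group_G gF)) (G_ginv hu Ga) H1)).
  move=> _ [_ [b Nb <-] <-].
  by rewrite (Gmull hu Ga (group_G gF (NF _ Nb))).
split; last exact: key.
apply: Fcl; apply: key; apply: nb_F => //; exact: (group_u gF).
Qed.

Lemma Lim_act t p q a : Lim p q a -> Lim (dact t p) (dact t q) a.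
Proof. by move=> [Fa La]; split=> // N /La; exact: co_dact. Qed.

Lemma Lim_limit p q a : F a ->
  (forall O, nbhs ((p, q) : M * M) O -> cl [set b | exists2 w, O w & Lim w.1 w.2 b] a) ->
  Lim p q a.
Proof.
move=> Fa H1; split=> // N /(nb_open hu gF Fa)[O [Oa ON Oo]].
apply: (coS ON); have : closure [set w : M * M | co w.1 O w.2] (p, q).
  move=> V /H1 Va.
  have LF : [set b | exists2 w, V w & Lim w.1 w.2 b] `<=` F by move=> b [w _ []].
  have [b [w Vw Lw] Ob] := cl_nb LF Va (Oo _ Oa).
  by exists w; split=> //; apply: Lw.2; exact: Oo.
by move=> /co_closed_rel.
Qed.

Lemma Lim_closed B : B `<=` F -> cl B `<=` B ->
  closed [set w : M * M | exists2 b, B b & Lim w.1 w.2 b].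
Proof.
move=> BF clB [p q] pq.
have [|_ _ [O pO ->] [V pV ->]|_ [O pO ->]|a Ba aP] := @tau_compact _ _ _ hu B
  (fun C => exists2 O, nbhs ((p, q) : M * M) O &
     C = [set b | B b /\ exists2 w, O w & Lim w.1 w.2 b]) clB.
- by eexists; exists setT; [exact: filterT|reflexivity].
- exists [set b | B b /\ exists2 w, (O `&` V) w & Lim w.1 w.2 b].
    by exists (O `&` V) => //; exact: filterI.
  by move=> b [Bb [w [Ow Vw] Lw]]; split; split=> //; exists w.
- by have [w [[b Bb Lb] Ow]] := pq _ pO; exists b; split=> //; split=> //; exists w.
exists a => //; apply: Lim_limit; first exact: BF.
move=> O pO; have := aP _ (ex_intro2 _ _ O pO erefl).
by move=> H1; apply: (cl_mono H1) => b [].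
Qed.

Section SB.
Variable B : set M.
Hypothesis gB : is_group u B.
Hypothesis Bcl : cl B `<=` B.
Hypothesis BF : B `<=` F.
Hypothesis HB : derived u F `<=` B.

(** Meant as the relation of an a.p. extension of [M / circ_rel F]. Values of [Lim] are determined
    only modulo [derived u F], whence the assumption [HB]. *)
Definition SB : set (M * M) := [set w | exists2 b, B b & Lim w.1 w.2 b].

Definition coc (p q : M) := inv (u ** p) ** (u ** q).

Lemma Lim_coc p q a : Lim p q a -> derived u F (inv a ** coc p q).
Proof. by move=> /(Lim_coset u); rewrite hu. Qed.

Lemma coc_G p q : G (coc p q).
Proof. by apply: G_ma; apply: G_ginv => //; exact: G_u. Qed.

Lemma Lim_B p q a : Lim p q a -> B a <-> B (coc p q).
Proof.
move=> L; have Fa := L.1; have Ga := group_G gF Fa; have /HB Ba := Lim_coc L.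
split=> [aB|cB].
  by rewrite -(GmullV hu Ga (coc_G p q)); exact: (group_mul gB).
have -> : a = coc p q ** inv (inv a ** coc p q).
  rewrite (ginvM hu) //; [|exact: G_ginv|exact: coc_G].
  by rewrite (ginvK hu Ga) maA (ginvr hu (coc_G p q)).
by apply: (group_mul gB) => //; exact: (group_inv gB).
Qed.

(** From the explicit cocycle the equivalence axioms are algebra in [G]; closedness and invariance
    are read off [Lim] instead. *)
Lemma SBP p q : SB (p, q) <-> co p F q /\ B (coc p q).
Proof.
split=> [[b Bb L]|[pq Bpq]].
  by split; [exact: Lim_co L|exact: (Lim_B L).1].
have [a Fa L] := Lim_ex (@subset_refl _ F) Fcl pq.
by exists a => //; apply/(Lim_B L).
Qed.

Lemma SB_icer : is_icer SB.
Proof.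
have Gp p : G (u ** p) by exact: G_u.
split.
- exact: Lim_closed.
- move=> p; apply/SBP; split; first exact: E_refl.
  by rewrite /coc (ginvl hu (Gp p)); exact: (group_u gB).
- move=> p q /SBP[pq Bpq]; apply/SBP; split; first exact: E_sym.
  have := group_inv gB Bpq; rewrite /coc (ginvM hu) ?(ginvK hu) //.
  exact: G_ginv.
- move=> p q r /SBP[pq Bpq] /SBP[qr Bqr]; apply/SBP; split; first exact: E_trans qr.
  have := group_mul gB Bpq Bqr.
  by rewrite /coc -(maA (inv (u ** p))) (GmullV hu (Gp q) (Gp r)).
- by move=> t p q [b Bb L]; exists b => //; exact: Lim_act.
Qed.

Lemma E_SB A : A `<=` B -> cl A `<=` A -> circ_rel A `<=` SB.
Proof.
move=> AB clA [p q] pq.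
have [a Aa L] := Lim_ex (subset_trans AB BF) clA pq.
by exists a => //; exact: AB.
Qed.

Lemma SB_sub : SB `<=` circ_rel F.
Proof. by move=> [p q] /SBP[]. Qed.

Lemma SB_u a : F a -> SB (u, a) -> B a.
Proof.
move=> Fa /SBP[_]; rewrite /coc hu (ginv_u hu) maA hu.
by have -> : u ** a = a by exact: (group_G gF Fa).
Qed.

(* [SB] contains the regionally proximal pairs. *)
Lemma SB_regprox p q :
  (forall O, nbhs ((p, q) : M * M) O -> exists2 w, SB w &
     closure [set v | exists t w, (O w /\ circ_rel F w) /\ v = (dact t w.1, dact t w.2)] w) ->
  SB (p, q).
Proof.
move=> rp.
pose L O := [set b : M | exists2 w : M * M, O w & Lim w.1 w.2 b].
have LF O : L O `<=` F by move=> b [w _ []].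
have [|_ _ [O pO ->] [V pV ->]|_ [O pO ->]|a Ba aP] := @tau_compact _ _ _ hu B
  (fun C => exists2 O, nbhs ((p, q) : M * M) O & C = cl (L O)) Bcl.
- by eexists; exists setT; [exact: filterT|reflexivity].
- exists (cl (L (O `&` V))).
    by exists (O `&` V) => //; exact: filterI.
  by move=> b bL; split; apply: (cl_mono bL) => c [w [Ow Vw] Lw]; exists w.
- have [[r r'] [b Bb Lb] rcl] := rp _ pO.
  have clF : cl (L O) `<=` F by move=> c /(clS (LF O))/Fcl.
  have : closure [set w : M * M | exists2 b, cl (L O) b & Lim w.1 w.2 b] (r, r').
    apply: closure_subset rcl => _ [t [[x x'] [[Ox Ex] ->]]].
    have [c Fc Lc] := Lim_ex (@subset_refl _ F) Fcl Ex.
    exists c; last exact: Lim_act.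
    by apply: cl_sub; [exact: (subset_trans (LF O) (group_G gF))|exists (x, x')].
  move=> /(Lim_closed clF (@cl_cl _ _ _ hu _)) [c cL Lc].
  by exists c; split=> //; apply/(Lim_B Lc); apply/(Lim_B Lb).
exists a => //; apply: Lim_limit; first exact: BF.
move=> O pO; apply: (@cl_cl _ _ _ hu); exact: aP (ex_intro2 _ _ O pO erefl).
Qed.

End SB.
End Limits.
End Icers.

(** * Topological transitivity *)

Section WeakMixing.
Variables (T : monoid) (M : umin T).
Local Notation "p ** z" := (@ma T M _ p z) (at level 40, left associativity).
Implicit Types p q r a b : M.

(* The closure of [F] is minimal for the right action of [F]. *)
Definition rminimal (F : set M) := forall q, closure F q ->
  forall V : set M, open V -> V `&` F !=set0 -> exists2 b, F b & V (q ** b).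

(** In the class of an idempotent [e], a closed set [N] minimal under right multiplication by the
    group at [e] contains an idempotent [w]. Left multiplication by [e] and [w] identifies the
    groups at [e] and at [w], so minimality of [N] passes to the closure of the latter. *)
Lemma rminimal_idem (S : set (M * M)) : is_icer S ->
  exists2 u : M, idem u & rminimal (egroup u S).
Proof.
move=> hS.
have [||e _ ee] := @idem_exists T M setT _ closedT; first by have [p _] := um_point M; exists p.
  by [].
pose I := {b : M | egroup e S b}.
have rc (b : M) : continuous (fun q : M => q ** b) by exact: ma_continuous.
have [||i q /= Sq|N [[n Nn] cN iN NC Nmin]] := @min_inv M (@cdyn_compact _ M) I
    (fun i q => q ** sval i) [set q | S (e, q)].
- by exists e; exact: (icer_refl hS).
- apply: (@closed_preim _ _ (fun q => (e, q)) S); last exact: icer_closed hS.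
  by apply: pair_continuous => x; [exact: cvg_cst|exact: cvg_id].
- case: i => b [Gb Sb] /=; apply: (icer_trans hS Sq).
  by have := icer_ma q hS Sb; rewrite (ma_idem _ ee).
have [w ww wn] : exists2 w : M, idem w & w ** n = n by apply: fix_idem; exact: um_morb.
have Gen : ellis_group e (e ** n) by exact: G_u.
have Fen : egroup e S (e ** n).
  by split=> //; have := icer_ma e hS (NC _ Nn); rewrite ee.
have Nw : N w.
  have := iN (exist _ _ (group_inv (egroup_group ee hS) Fen)) _ Nn.
  rewrite /= -{1}wn -{1}(ma_idem w ee) -(maA w) -(maA w) (ginvr ee Gen) (ma_idem _ ee).
  by [].
have FN : egroup w S `<=` N.
  move=> a [Ga Sa].
  have Fea : egroup e S (e ** a).
    split; first exact: G_u.
    by have := icer_ma e hS Sa; rewrite (ma_idem _ ww).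
  by have := iN (exist _ _ Fea) _ Nw; rewrite /= maA (ma_idem _ ee) Ga.
exists w => // q Fq V oV [a [Va Fa]].
have Nq : N q by apply: cN; exact: closure_subset FN _ Fq.
have Eq : closure [set r | exists i : I, r = q ** sval i] = N.
  apply: Nmin.
  - exists q; apply: subset_closure; exists (exist _ _ (group_u (egroup_group ee hS))).
    by rewrite /= ma_idem.
  - exact: closed_closure.
  - move=> i r rc' V' rV'.
    have [_ [[k ->] kV]] := rc' _ (rc (sval i) _ _ rV').
    exists (q ** sval k ** sval i); split=> //.
    exists (exist _ _ (group_mul (egroup_group ee hS) (proj2_sig k) (proj2_sig i))).
    by rewrite /= maA.
  - by move=> r rc'; apply: cN; apply: closure_subset rc' => _ [i ->]; exact: iN.
have : closure [set r | exists i : I, r = q ** sval i] a by rewrite Eq; exact: FN.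
move=> /(_ V (open_nbhs_nbhs (conj oV Va))) [_ [[[b [Gb Sb]] ->] /= Vb]].
exists (w ** b); last by rewrite maA (ma_idem _ ww).
split; first exact: G_u.
by have := icer_ma w hS Sb; rewrite (ma_idem _ ee).
Qed.

Section Fixed.
Variable u : M.
Hypothesis hu : idem u.
Local Notation G := (ellis_group u).
Local Notation inv := (ginv u).
Local Notation cl := (tau_cl u).

Section Interior.
Variable F : set M.
Hypothesis gF : is_group u F.
Hypothesis Fcl : cl F `<=` F.
Hypothesis Fmin : rminimal F.

Lemma cl_rset (B : set M) g : G g -> cl (rset (cl B) g) `<=` rset (cl B) g.
Proof.
move=> Gg x clx; exists (x ** inv g); last by rewrite (GmulrV hu).
apply: (@cl_cl _ _ _ hu); apply: (cl_mono (cl_rmul (inv g) clx)).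
by move=> _ [_ [b Bb <-] <-]; rewrite (Gmulr hu).
Qed.

(* A Baire-type argument: finitely many right translates of [V `&` F] cover [F],
   so their tau-closures cannot all be nowhere dense. *)
Lemma tau_interior (V : set M) : open V -> V `&` F !=set0 ->
  exists2 w, F w & nb u F (cl (V `&` F)) w.
Proof.
move=> oV VF; apply: contrapT => now.
set O := V `&` F in now *.
have OF : O `<=` F by move=> x [].
have clOF : cl O `<=` F by move=> x /(clS OF)/Fcl.
have dense x : F x -> cl (F `\` cl O) x.
  by move=> Fx; apply: contrapT => nx; apply: now; exists x.
have FG := group_G gF.
pose Dg g := F `\` rset (cl O) g.
have denseg g x : F g -> F x -> cl (Dg g) x.
  move=> Fg Fx; rewrite -(GmulrV hu x (FG _ Fg)).
  have Fxg : F (x ** inv g) by apply: (group_mul gF) => //; exact: (group_inv gF).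
  apply: (cl_mono (cl_rmul g (dense _ Fxg))) => _ [y [Fy ny] <-].
  split; first exact: (group_mul gF).
  move=> [z Oz] /(congr1 (fun m => m ** inv g)); rewrite !(Gmulr hu _ (FG _ Fg)) => zy.
  by apply: ny; rewrite -zy.
(* [D s] is what is left of [F] after deleting the translates of [cl O] by the entries of [s]. If
   [cl O] has no tau-interior, each [D s] is tau-dense, so these sets generate a proper filter. *)
pose D := fix D (s : seq M) := if s is g :: s' then D s' `&` Dg g else F.
have denses : forall s : seq M, (forall g, g \in s -> F g) -> forall x, F x -> cl (D s) x.
  elim=> [_ x Fx|g s IHs sF x Fx] /=; first by apply: cl_sub.
  have Fg : F g by apply: sF; rewrite inE eqxx.
  have Fs g' : g' \in s -> F g' by move=> g's; apply: sF; rewrite inE g's orbT.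
  apply: (@cl_cl _ _ _ hu); apply: (cl_mono (denseg _ _ Fg Fx)) => y [Fy ny].
  have : cl ((D s `&` Dg g) `|` rset (cl O) g) y.
    apply: (cl_mono (IHs Fs _ Fy)) => z Dz.
    have [Oz|nOz] := pselect (rset (cl O) g z); [by right|left; split=> //].
    split=> //; elim: (s) Dz => //= g' s' IH [].
    by move=> /IH.
  by move=> /clU[//|/(cl_rset (FG _ Fg))].
have Dcat s s' : D (s ++ s') `<=` D s `&` D s'.
  elim: s => [|g s IHs] /=; last by move=> x [/IHs[? ?] ?].
  by elim: s' => [|g s' IH] //= x [/IH[? ?] ?].
have [||A|W [UW BW]] := @ultra_ext M (fun A => A = setT \/
   exists2 s : seq M, (forall g, g \in s -> F g) & A = D s); first by left.
- move=> A C [->|[s sF ->]] [->|[s' sF' ->]].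
  + by exists setT; split; [left|].
  + by exists (D s'); split; [right; exists s'|].
  + by exists (D s); split; [right; exists s|].
  + exists (D (s ++ s')); split; last exact: Dcat.
    right; exists (s ++ s') => // g; rewrite mem_cat => /orP[]; [exact: sF|exact: sF'].
- move=> [->|[s sF ->]]; first by exists u.
  have [_ /(_ setT filterT)/bt_ex[t [b Db _]]] := denses s sF u (group_u gF).
  by exists b.
have [m mW] := ultra_lim id (@cdyn_compact _ M) UW.
have mF : closure F m.
  move=> N /mW WN.
  have WF : W F by apply: BW; right; exists [::].
  exact: (filter_ex (filterI WF WN)).
(* Some [b] moves the limit [m] into [V]. Points of [F] near [m] then lie in the translate of [O] by
   [inv b], one of those deleted. *)
have [b Fb Vb] := Fmin mF oV VF.
have mV : nbhs m [set q : M | V (q ** b)].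
  by apply: ma_continuous; exact: open_nbhs_nbhs.
have Fib := group_inv gF Fb.
have WD : W (D [:: inv b]).
  by apply: BW; right; exists [:: inv b] => // g; rewrite inE => /eqP ->.
have WI : W (D [:: inv b] `&` [set q : M | V (q ** b)]) by apply: filterI WD (mW _ mV).
have [q [[Fq [_ nq]] Vq]] := filter_ex WI.
apply: nq; exists (q ** b); last by rewrite (Gmulr hu _ (FG _ Fb)).
apply: cl_sub; first exact: (subset_trans OF FG).
by split=> //; exact: (group_mul gF).
Qed.

End Interior.

(** The idempotent [u] need not fix [dact t z]; another one comes from the elements of [M] that
    do. *)
Lemma ap_orbit (Z : cdyn T) t (z : Z) : u ** z = z -> ap_point (@dact T Z) (dact t z).
Proof.
move=> uz; apply/(@ap_fix T M); apply: fix_idem.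
have [p pE] := um_morb (dact t u) (dact t u); exists p.
by rewrite -uz dact_ma maA pE.
Qed.

Section Mixing.
Variables (X : cdyn T) (phi : M -> X).
Hypothesis cphi : continuous phi.
Hypothesis ephi : forall t p, phi (dact t p) = dact t (phi p).
Variables (S : set (M * M)) (A : set M).
Local Notation F := (egroup u S).
Hypothesis hS : is_icer S.
Hypothesis SE : S `<=` circ_rel F.
Hypothesis Fmin : rminimal F.
Hypothesis gA : is_group u A.
Hypothesis AF : A `<=` F.
Hypothesis phiA : forall a p, A a -> phi (p ** a) = phi p.
Hypothesis FHA : F `<=` cl (HA u F A).

Let gF : is_group u F := egroup_group hu hS.
Let Fcl : cl F `<=` F := egroup_cl hu hS.
Let FG := group_G gF.
Let XX := prod_cdyn X X.
Let L := (fun w : M * M => (phi w.1, phi w.2)) @` S.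

Lemma phi_ma p q : phi (p ** q) = p ** phi q.
Proof. exact: (@ma_morph T M M X phi p q cphi ephi). Qed.

(* The orbit of [F u] is dense in [S], so that open sets meeting [L] contain
   some [t (phi u, phi a)] with [a] in [F]. *)
Lemma L_point (U : set (X * X)) : open U -> U `&` L !=set0 ->
  exists t a, F a /\ U (dact t (phi u), dact t (phi a)).
Proof.
move=> oU [x [Upq [[p q] /= Spq xE]]]; rewrite -xE in Upq.
have [[U1 U2] /= [U1p U2q] U12] : nbhs (phi p, phi q) U by exact: open_nbhs_nbhs.
have pU : nbhs (p ** u) (phi @^-1` U1) by rewrite (ma_u hu); exact: cphi.
have qU : nbhs q (phi @^-1` U2) by exact: cphi.
have [t [[a Fa /= ta] tu]] := bt_exI (SE Spq qU) (uactP pU).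
by exists t, a; split=> //; apply: U12; split; rewrite /= -ephi.
Qed.

(** The tau-interior given by [tau_interior] contains some [k = h ** a], as such products are
    tau-dense in [F]. Translated back to [u], it is a neighborhood whose closure contains the normal
    subgroup [derived u F]. *)
Lemma H_translate (O : set M) : open O -> O `&` F !=set0 ->
  exists h a, [/\ derived u F h, A a & forall h', derived u F h' -> cl (O `&` F) (h' ** (h ** a))].
Proof.
move=> oO OF; have [w Fw wO] := tau_interior gF Fcl Fmin oO OF.
have [W [Ww WO Wo]] := nb_open hu gF Fw wO.
have HAF : HA u F A `<=` F.
  by move=> _ [h [a [[Fh _] Aa ->]]]; apply: (group_mul gF) => //; exact: AF.
have [_ [h [a [Hh Aa ->]]] Wk] := cl_nb HAF (FHA Fw) (Wo _ Ww).
exists h, a; split=> // h' Hh'.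
set k := h ** a in Wk *.
have Fk : F k by apply: HAF; exists h, a.
have Gk := FG Fk.
have Wku : nb u F (lset (inv k) W) u.
  by have := nb_lmul hu gF (group_inv gF Fk) Fk (Wo _ Wk); rewrite (ginvl hu Gk).
have [WF _] := Wku.
have [_ /(_ _ Wku) H1] := H_conj hu gF Fk Hh'.
have := cl_lmul hu (subset_trans WF FG) Gk H1.
rewrite -(maA (inv k)) (GmullV hu Gk) //; last first.
  by apply: FG; apply: (group_mul gF) => //; case: Hh'.
move=> H2; apply: (@cl_cl _ _ _ hu); apply: (cl_mono H2) => _ [_ [y Wy <-] <-].
have [WF' _] := Wo _ Wk; have Fy := WF' _ Wy.
by rewrite (GmullV hu Gk (FG Fy)); exact: WO.
Qed.

(** The orbit closure [Z] of the product of the images of two small pieces of [F] is enlarged in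
    three rounds: it contains the image of the square of the derived group, then of [HA u F A], then
    of [F]. Each limit runs along the same [u] in both coordinates, so [circ_prod] applies. *)
Lemma core (U : set (X * X)) a b (V : set (X * X)) : F a -> F b ->
  nbhs (phi u, phi a) U -> nbhs (phi u, phi b) V ->
  exists t g1 g2, [/\ F g1, F g2, U (phi g1, phi g2) &
    V (dact t (phi g1), dact t (phi g2))].
Proof.
move=> Fa Fb [[U1 U2] /= [U1u U2a] U12] uV.
pose O1 := phi @^-1` U1^°; pose O2 := phi @^-1` U2^°.
have /continuousP cphi' := cphi.
have oO1 : open O1 by apply: cphi'; exact: open_interior.
have oO2 : open O2 by apply: cphi'; exact: open_interior.
have Fu := group_u gF.
have [|h1 [a1 [Hh1 Aa1 HO1]]] := H_translate oO1; first by exists u.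
have [|h2 [a2 [Hh2 Aa2 HO2]]] := H_translate oO2; first by exists a.
pose B := (phi @` (O1 `&` F)) `*` (phi @` (O2 `&` F)).
pose Z : set XX := closure [set v : XX | exists t w, B w /\ v = (dact t w.1, dact t w.2)].
have cZ : closed Z by exact: closed_closure.
have iZ t (v : XX) : Z v -> Z (dact t v).
  move=> Zv W /dact_nbhs/Zv[_ [[s [w [Bw ->]]] sW]].
  exists (dact t ((dact s w.1, dact s w.2) : XX)); split=> //.
  by exists (mmul t s), w; split=> //; rewrite !dactM.
have BZ : B `<=` Z.
  move=> w Bw; apply: subset_closure; exists (mone T), w; split=> //.
  by rewrite !dact1 -surjective_pairing.
have phico (C : set M) c : cl C c -> co u (phi @` C) (phi c).
  by move=> [_]; exact: circ_morph.
have gH := H_group hu gF.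
have ZH g1 g2 : derived u F g1 -> derived u F g2 -> Z (phi g1, phi g2).
  (* With [h' = g ** inv h] the product with [h ** c] becomes [g ** c], and [phi] ignores [c]. *)
  have trick h g c C : derived u F h -> derived u F g -> A c ->
      (forall h', derived u F h' -> cl C (h' ** (h ** c))) -> co u (phi @` C) (phi g).
    move=> Hh Hg Ac HC; have HG := group_G gH.
    have := HC _ (group_mul gH Hg (group_inv gH Hh)).
    by rewrite maA (GmulrV hu g (HG _ Hh)) => /phico; rewrite phiA.
  move=> Hg1 Hg2; apply: (@circ_inv T XX (uj u) B) => //.
  by apply: circ_prod; [exact: trick HO1|exact: trick HO2].
have ZHA g1 g2 : HA u F A g1 -> HA u F A g2 -> Z (phi g1, phi g2).
  move=> [k1 [c1 [Hk1 Ac1 ->]]] [k2 [c2 [Hk2 Ac2 ->]]].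
  by rewrite !phiA //; exact: ZH.
have : Z (phi u, phi b).
  apply: (@circ_inv T XX (uj u) ((phi @` HA u F A) `*` (phi @` HA u F A))) => //.
    by move=> [_ _] [/= [g1 H1 <-] [g2 H2 <-]]; exact: ZHA.
  by apply: circ_prod; apply: phico; exact: FHA.
move=> /(_ _ uV)[_ [[t [[x1 x2] [[/= [g1 [O1g1 Fg1] <-] [g2 [O2g2 Fg2] <-]] ->]]] tV]].
exists t, g1, g2; split=> //; apply: U12; split; exact: interior_subset.
Qed.

Lemma mixing : M_set (act2 T X) L.
Proof.
have Fu := group_u gF.
have LF t g1 g2 : F g1 -> F g2 -> L (dact t (phi g1), dact t (phi g2)).
  move=> Fg1 Fg2; exists (dact t g1, dact t g2); last by rewrite /= !ephi.
  apply: (icer_act hS).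
  exact: (icer_trans hS (icer_sym hS Fg1.2) Fg2.2).
have apL t g1 g2 : F g1 -> F g2 ->
    ap_point (act2 T X) (dact t (phi g1), dact t (phi g2)).
  move=> /FG Fg1 /FG Fg2; apply: (@ap_orbit XX t (phi g1, phi g2)).
  by rewrite ma_pair -!phi_ma Fg1 Fg2.
split; first by exists (phi u, phi u), (u, u) => //; exact: icer_refl.
split; last first.
  move=> W oW /(L_point oW)[t [a [Fa Wa]]].
  by exists (dact t (phi u), dact t (phi a)); split; [exact: LF|split=> //; exact: apL].
move=> U V oU oV /(L_point oU)[t [a [Fa Ua]]] /(L_point oV)[s [b [Fb Vb]]].
have nU : nbhs ((phi u, phi a) : XX) [set z : XX | U (dact t z)].
  by apply: dact_nbhs; exact: open_nbhs_nbhs.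
have nV : nbhs ((phi u, phi b) : XX) [set z : XX | V (dact s z)].
  by apply: dact_nbhs; exact: open_nbhs_nbhs.
have [t' [g1 [g2 [Fg1 Fg2 Ug Vg]]]] := core Fa Fb nU nV.
pose z : XX := (phi g1, phi g2).
have uz : u ** z = z by rewrite ma_pair -!phi_ma (FG Fg1) (FG Fg2).
(* Substitute for the inverse of [t]: this [p] sends [dact t z] back to [z]. *)
have [p pE] := um_morb (dact t u) u.
have pz : p ** dact t z = z by rewrite -{1}uz dact_ma maA pE.
have zV : nbhs (p ** dact t z) [set y : XX | V (dact s (dact t' y))].
  rewrite pz; apply: (@dact_nbhs T XX t' z [set y : XX | V (dact s y)]).
  by apply: (@dact_nbhs T XX s _ V); exact: open_nbhs_nbhs.
have [s' s'V] := bt_ex (uactP zV).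
exists (mmul s (mmul t' s')), (dact t z); split; first exact: LF.
split; first exact: Ug.
have -> : act2 T X (mmul s (mmul t' s')) (dact t z) =
   @dact T XX s (dact t' (dact s' (dact t z))).
  by rewrite -(@dactM T XX t' s') -(@dactM T XX s).
exact: s'V.
Qed.

End Mixing.

End Fixed.
End WeakMixing.

(** * Towers *)

(* Transfinite iteration of a deflationary operator [next] on sets, after
   Bourbaki and Witt. *)
Section Tower.
Variables (W : Type) (S0 : set W) (next : set W -> set W).
Hypothesis next_sub : forall S, next S `<=` S.
#[local] Hint Resolve next_sub : core.

Inductive tow : set W -> Prop :=
| tow0 : tow S0
| tow_next S : tow S -> tow (next S)
| tow_cap (C : set (set W)) : C !=set0 -> (forall S, C S -> tow S) ->
    tow (\bigcap_(S in C) S).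

Lemma tow_sub S : tow S -> S `<=` S0.
Proof.
elim=> [|R _ IH|C [R CR] _ IH] //; first exact: subset_trans IH.
by move=> w Cw; apply: (IH R) => //; exact: Cw.
Qed.

(** The Bourbaki-Witt condition that [next] never jumps past [c]; it makes [c] comparable with every
    stage. *)
Definition extreme (c : set W) :=
  forall x, tow x -> c `<=` x -> x <> c -> c `<=` next x.

Lemma extreme_cmp c x : tow c -> extreme c -> tow x -> c `<=` x \/ x `<=` next c.
Proof.
move=> tc ec; elim=> [|y ty [cy|yc]|C _ tC IH].
- by left; exact: tow_sub.
- have [->|yc] := pselect (y = c); first by right.
  by left; exact: ec.
- by right; apply: subset_trans yc.
- have [allC|] := pselect (forall x, C x -> c `<=` x).
    by left=> w cw z Cz; exact: (allC z).
  move=> /existsNP[y /not_implyP[Cy ncy]]; right.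
  by have [//|yc] := IH _ Cy; move=> w Cw; apply: yc; exact: Cw.
Qed.

Lemma tow_extreme c : tow c -> extreme c.
Proof.
elim=> [|d td ed|C C0 tC IH] x tx cx xc.
- by case: xc; rewrite eqEsubset; split=> //; exact: tow_sub.
- have [cx'|xnc] := extreme_cmp td ed tx; last first.
    by case: xc; rewrite eqEsubset; split.
  have [->//|xc'] := pselect (x = d).
  by apply: subset_trans (ed _ tx cx' xc').
- have [|/existsNP[d /not_implyP[Cd nxd]]] := pselect (forall d, C d -> x `<=` d).
    move=> H; case: xc; rewrite eqEsubset; split=> //.
    by move=> w xw d Cd; exact: (H d).
  have dx : d `<=` x.
    have [//|xnd] := extreme_cmp (tC _ Cd) (IH _ Cd) tx.
    by case: nxd; apply: subset_trans xnd _.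
  have [xd|xd] := pselect (x = d).
    have [xC|] := extreme_cmp (tC _ Cd) (IH _ Cd) (tow_cap C0 tC).
      by case: xc; rewrite eqEsubset; split=> //; rewrite xd.
    by rewrite xd.
  have dnx := IH _ Cd x tx dx xd.
  by move=> w Cw; apply: dnx; exact: Cw.
Qed.

Lemma tow_cmp c x : tow c -> tow x -> c `<=` x \/ x `<=` next c.
Proof. by move=> tc; apply: extreme_cmp => //; exact: tow_extreme. Qed.

Lemma tow_fix_least c x : tow c -> next c = c -> tow x -> c `<=` x.
Proof.
move=> tc nc; elim=> [|y ty cy|C _ _ IH].
- exact: tow_sub.
- have [->|yc] := pselect (y = c); first by rewrite nc.
  exact: (tow_extreme tc).
- by move=> w cw z Cz; exact: (IH z).
Qed.

(** Let [J] be the least stage above all of [C]. If no member of [C] contained [J], all would lie in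
    [next J], forcing [next J = J]; but a fixed stage is contained in every stage. *)
Lemma tow_greatest (C : set (set W)) : C !=set0 -> C `<=` tow ->
  exists2 c, C c & forall d, C d -> d `<=` c.
Proof.
move=> [c0 Cc0] Ct.
pose D := [set x | tow x /\ forall c, C c -> c `<=` x].
have D0 : D !=set0 by exists S0; split; [exact: tow0|move=> c /Ct; exact: tow_sub].
pose J := \bigcap_(S in D) S.
have tJ : tow J by apply: tow_cap => // S [].
have CJ c : C c -> c `<=` J by move=> Cc w cw S [_ HS]; exact: (HS c).
apply: contrapT => noC.
have CnJ c : C c -> c `<=` next J.
  move=> Cc; have [Jc|//] := tow_cmp tJ (Ct _ Cc).
  case: noC; exists c => // d /CJ dJ; exact: subset_trans Jc.
have DnJ : D (next J) by split; [exact: tow_next|].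
have nJ : next J = J.
  by rewrite eqEsubset; split=> // w Jw; exact: (Jw _ DnJ).
apply: noC; exists c0 => // d /CJ dJ; apply: subset_trans dJ _.
exact: tow_fix_least (Ct _ Cc0).
Qed.

Definition tidx : Type := {S : set W | tow S}.
Definition tlt (a b : tidx) : Prop := sval b `<=` sval a /\ sval a <> sval b.

Lemma tidx_ext (a b : tidx) : sval a = sval b -> a = b.
Proof.
case: a => a ta; case: b => b tb /= E.
by move: ta; rewrite E => ta; rewrite (Prop_irrelevance ta tb).
Qed.

Lemma tlt_order : strict_well_order tlt.
Proof.
split.
  move=> a b c [ba nab] [cb nbc]; split; first exact: subset_trans cb ba.
  by move=> ac; apply: nbc; rewrite eqEsubset; split=> //; rewrite -ac.
split.
  move=> a b; have [E|nE] := pselect (sval a = sval b).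
    by right; left; exact: tidx_ext.
  have [ab|ba] := tow_cmp (proj2_sig a) (proj2_sig b).
    by right; right; split=> //; exact: nesym.
  by left; split=> //; exact: subset_trans ba _.
move=> a; apply: contrapT => na.
pose C := [set S | exists2 b : tidx, sval b = S & ~ Acc tlt b].
have [||_ [b <- nb] bmax] := @tow_greatest C.
- by exists (sval a), a.
- by move=> _ [b <- _]; exact: proj2_sig.
apply: nb; split=> c [bc cb]; apply: contrapT => nc.
by apply: cb; rewrite eqEsubset; split=> //; apply: bmax; exists c.
Qed.

Definition ttop : tidx.
Proof.
by exists (\bigcap_(S in tow) S); apply: tow_cap => //; exists S0; exact: tow0.
Defined.

Lemma ttop_max g : g = ttop \/ tlt g ttop.
Proof.
have [E|nE] := pselect (sval g = sval ttop); first by left; exact: tidx_ext.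
by right; split=> // w; apply; exact: proj2_sig.
Qed.

Lemma ttop_next : next (sval ttop) = sval ttop.
Proof.
rewrite eqEsubset; split=> // w; apply; apply: tow_next; exact: proj2_sig.
Qed.

Lemma tidx_least g : (forall l, ~ tlt l g) -> sval g = S0.
Proof.
move=> gmin; apply: contrapT => ng; apply: (gmin (exist _ S0 tow0)).
by split; [exact: tow_sub (proj2_sig g)|exact: nesym].
Qed.

Lemma tidx_next g d : tlt g d -> (forall m, ~ (tlt g m /\ tlt m d)) ->
  sval d = next (sval g) /\ next (sval g) <> sval g.
Proof.
move=> [dg ngd] between.
have dng : sval d `<=` next (sval g).
  have [gd|//] := tow_cmp (proj2_sig g) (proj2_sig d).
  by case: ngd; rewrite eqEsubset.
have nng : next (sval g) <> sval g.
  move=> E; apply: ngd; rewrite eqEsubset; split=> //.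
  exact: tow_fix_least (proj2_sig g) E (proj2_sig d).
split=> //; apply: contrapT => nd.
apply: (between (exist _ (next (sval g)) (tow_next (proj2_sig g)))).
split; split=> //=; exact: nesym.
Qed.

(** Were the intersection of the earlier stages larger than [g], it would be a stage before [g]; a
    stage between the two would both contain it and be properly contained in it. *)
Lemma tidx_limit g : (exists l, tlt l g) ->
  (forall l, tlt l g -> exists m, tlt l m /\ tlt m g) ->
  forall w, (forall l, tlt l g -> sval l w) -> sval g w.
Proof.
move=> [l0 l0g] lim.
pose C := [set S | exists2 l : tidx, sval l = S & tlt l g].
have tJ : tow (\bigcap_(S in C) S).
  by apply: tow_cap; [exists (sval l0), l0|move=> _ [l <- _]; exact: proj2_sig].
have gJ : sval g `<=` \bigcap_(S in C) S by move=> w gw _ [l <- [gl _]]; exact: gl.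
suff E : \bigcap_(S in C) S = sval g.
  by move=> w H; rewrite -E => _ [l <- lg]; exact: H.
apply: contrapT => nE.
have [m [[mJ nm] mg]] := lim (exist _ _ tJ) (conj gJ nE).
by apply: nm; rewrite eqEsubset; split=> //= w Jw; apply: Jw; exists m.
Qed.

End Tower.

(** * Proximal and almost periodic steps *)

Section Factors.
Variables (T : monoid) (M : umin T).
Local Notation "p ** z" := (@ma T M _ p z) (at level 40, left associativity).
Implicit Types (p q : M) (S : set (M * M)).

Lemma icer_bigcap (C : set (set (M * M))) : (forall S, C S -> is_icer S) ->
  is_icer (\bigcap_(S in C) S).
Proof.
move=> Ci; split.
- by apply: closed_bigI => S CS; exact: (icer_closed (Ci _ CS)).
- by move=> p S CS; exact: (icer_refl (Ci _ CS)).
- by move=> p q pq S CS; apply: (icer_sym (Ci _ CS)); exact: pq.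
- move=> p q r pq qr S CS; exact: (icer_trans (Ci _ CS) (pq _ CS) (qr _ CS)).
- by move=> t p q pq S CS; apply: (icer_act (Ci _ CS)); exact: pq.
Qed.

Lemma icer_kernel (Z : cdyn T) (f : M -> Z) : continuous f ->
  (forall t p, f (dact t p) = dact t (f p)) -> is_icer [set w | f w.1 = f w.2].
Proof.
move=> cf ef; split=> //=.
- apply: (@closed_equalizer _ _ (f \o fst) (f \o snd)) => //.
    by apply: continuous_comp' cf; exact: fst_continuous.
  by apply: continuous_comp' cf; exact: snd_continuous.
- by move=> p q r -> ->.
- by move=> t p q; rewrite !ef => ->.
Qed.

(** Proximality of [M / S'] over [M / S]: an idempotent turns every pair of [S] into an a.p. pair,
    which [S'] identifies. *)
Definition prox_step S' S := forall p q, S (p, q) -> ap2 p q -> S' (p, q).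

(** Absence of nontrivial regionally proximal pairs, stated upstairs on [M], with [S'] in place of
    the diagonal. *)
Definition ap_step S' S := forall p q, S (p, q) ->
  (forall O, nbhs ((p, q) : M * M) O -> exists2 w, S' w &
     closure [set v | exists t w, (O w /\ S w) /\ v = (dact t w.1, dact t w.2)] w) ->
  S' (p, q).

Section Terminal.
Variables (X : cdyn T) (phi : M -> X).
Hypothesis cphi : continuous phi.
Hypothesis ephi : forall t p, phi (dact t p) = dact t (phi p).
Variables R S : set (M * M).
Hypothesis hR : is_icer R.
Hypothesis hS : is_icer S.
Hypothesis Rphi : R `<=` [set w | phi w.1 = phi w.2].
Hypothesis RS : R `<=` S.
Hypothesis Rmin : forall R', is_icer R' -> R' `<=` R -> prox_step R' R -> R `<=` R'.
Hypothesis Smin : forall S', is_icer S' -> R `<=` S' -> S' `<=` S ->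
  prox_step S' S \/ ap_step S' S -> S `<=` S'.

Lemma terminal_mixing :
  M_set (act2 T X) ((fun w : M * M => (phi w.1, phi w.2)) @` S).
Proof.
have [u hu Fmin] := rminimal_idem hS.
set F := egroup u S in Fmin; set A := egroup u R.
have gF : is_group u F := egroup_group hu hS.
have gA : is_group u A := egroup_group hu hR.
have Fcl : tau_cl u F `<=` F := egroup_cl hu hS.
have AF : A `<=` F by move=> a [Ga Ra]; split=> //; exact: RS.
(* [circ_rel A] contains the a.p. pairs of [R], so minimality of [R] applies; likewise below for [S]
   and [circ_rel F]. *)
have RE : R `<=` circ_rel A.
  apply: Rmin; [exact: (E_icer hu gA)|exact: (E_sub hu hR)|].
  by move=> p q Rpq; exact: (ap2_E hu hR).
have REF : R `<=` circ_rel F by move=> w /RE; exact: coS.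
have SE : S `<=` circ_rel F.
  apply: Smin; [exact: (E_icer hu gF)|exact: REF|exact: (E_sub hu hS)|].
  by left=> p q Spq; exact: (ap2_E hu hS).
have gHA := HA_group hu gF gA AF.
have gH := H_group hu gF.
set B := tau_cl u (HA u F A).
have gB : is_group u B := cl_group hu gHA.
have Bcl : tau_cl u B `<=` B := @cl_cl _ _ _ hu _.
have HAF : HA u F A `<=` F.
  by move=> _ [h [a [[Fh _] Aa ->]]]; apply: (group_mul gF) => //; exact: AF.
have BF : B `<=` F by move=> b /(clS HAF)/Fcl.
have HAB : HA u F A `<=` B by apply: cl_sub; exact: group_G gHA.
have HB : derived u F `<=` B.
  move=> h Hh; apply: HAB; exists h, u; split=> //; first exact: (group_u gA).
  by rewrite (ma_u hu).
have AB : A `<=` B.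
  move=> a Aa; apply: HAB; exists u, a; split=> //; first exact: (group_u gH).
  by apply/esym; exact: (group_G gA).
(* [SB u F B] is an a.p. step below [S] and above [R], so [S] cannot be larger. Reading this at
   pairs starting with [u] gives that [F] is contained in [B]. *)
have SSB : S `<=` SB u F B.
  apply: Smin.
  - exact: (SB_icer hu gF Fcl gB).
  - by move=> w /RE; apply: E_SB => //; exact: (egroup_cl hu hR).
  - by move=> w wSB; apply: (E_sub hu hS); exact: (SB_sub hu gF Fcl gB HB wSB).
  - right=> p q Spq rp; apply: SB_regprox => // O pO.
    have [w wS wcl] := rp O pO; exists w => //.
    apply: closure_subset wcl => _ [t [v [[Ov Sv] ->]]].
    by exists t, v; split=> //; split=> //; exact: SE.
have FB : F `<=` tau_cl u (HA u F A).
  move=> a Fa; apply: (SB_u hu gF Fcl gB HB Fa).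
  by apply: SSB; case: Fa.
apply: (@mixing T M u hu X phi cphi ephi S A) => //.
move=> a p [Ga Ra]; apply/esym.
by have := Rphi (icer_ma p hR Ra); rewrite /= (ma_u hu).
Qed.

End Terminal.

Section Quotients.

Lemma prox_ext_of (Z : cdyn T) S (hS : is_icer S) (f : qdyn hS -> Z) :
  (forall p q, f (cls S p) = f (cls S q) -> exists2 v : M, idem v & S (v ** p, v ** q)) ->
  proximal_ext f.
Proof.
move=> H [c d] /= cd.
have [v vv Sv] : exists2 v : M, idem v & S (v ** rep c, v ** rep d).
  by apply: H; rewrite !repK.
pose QQ := prod_cdyn (qdyn hS) (qdyn hS).
have ecls p : uact (uj v) (cls S p : qdyn hS) = cls S (v ** p).
  apply/esym; apply: (@uact_morph T M (qdyn hS) (cls S)).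
    exact: cls_continuous.
  by move=> t y; rewrite /= (qt_act_cls hS).
exists (@uact T QQ (uj v) (c, d)); split.
  by apply/(@orbit_closure T QQ); exists (uj v).
by rewrite uact_prod /diag /= -(repK c) -(repK d) !ecls; exact/(cls_eq hS).
Qed.

Variables (S S' : set (M * M)) (hS : is_icer S) (hS' : is_icer S').

(** Representatives make this total: the tower asks for a map between any two stages, even where no
    inclusion makes it meaningful. *)
Definition qmap (c : qdyn hS') : qdyn hS := cls S (rep c).

Hypothesis SS : S' `<=` S.

Lemma qmap_cls p : qmap (cls S' p) = cls S p.
Proof.
by apply/(cls_eq hS)/(icer_sym hS); apply: SS; exact: (rep_cls hS').
Qed.

Lemma qmap_continuous : continuous qmap.
Proof.
apply: qt_continuous; rewrite (_ : _ \o _ = cls S); first exact: cls_continuous.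
by apply/funext => p /=; exact: qmap_cls.
Qed.

Lemma qmap_ext : extension qmap.
Proof.
split; first exact: qmap_continuous.
split; last by move=> c; exists (cls S' (rep c)); rewrite qmap_cls repK.
by move=> t c; rewrite -(repK c) /= (qt_act_cls hS') !qmap_cls (qt_act_cls hS).
Qed.

Lemma qmap_prox (u : M) : idem u -> prox_step S' S -> proximal_ext qmap.
Proof.
move=> hu st; apply: prox_ext_of => p q; rewrite !qmap_cls => /(cls_eq hS) Spq.
exists u => //; apply: st; first exact: icer_ma.
by exists u => //; rewrite !maA hu.
Qed.

(* Regional proximality modulo [S'] descends to the quotient because the classes
   are compact: a saturated neighborhood basis of a class suffices. *)
Lemma qmap_ap : ap_step S' S -> ap_ext qmap.
Proof.
move=> st [c [d [cd [ncd rp]]]].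
have Sr : S (rep c, rep d) by apply/(cls_eq hS).
pose D (O : set (M * M)) : set (M * M) :=
  closure [set v : M * M | exists t w, (O w /\ S w) /\ v = (dact t w.1, dact t w.2)].
pose good (O : set (M * M)) := forall w, D O w -> ~ S' w.
pose sat (U V : set (qdyn hS')) := [set w : M * M | U (cls S' w.1) /\ V (cls S' w.2)].
have goodU O O' : good O -> good O' -> good (O `|` O').
  move=> gO gO' w Dw; have : closure
    ([set v : M * M | exists t w, (O w /\ S w) /\ v = (dact t w.1, dact t w.2)] `|`
     [set v : M * M | exists t w, (O' w /\ S w) /\ v = (dact t w.1, dact t w.2)]) w.
    apply: closure_subset Dw => _ [t [v [[[Ov|Ov] Sv] ->]]].
      by left; exists t, v.
    by right; exists t, v.
  by rewrite closureU => -[/gO|/gO'].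
have good0 : good set0 by move=> w Dw; have [x [[t [v [[v0 _] _]]] _]] := Dw setT filterT.
have sat0 : [set: M * M] = sat setT setT `\` set0.
  by rewrite setD0 eqEsubset.
have [U [V [O [cU dV gO UVO]]]] : exists U V O, [/\ nbhs c U, nbhs d V, good O & sat U V `<=` O].
  (* Otherwise an ultrafilter contains every [sat U V] minus any good set. Its limit [(p1, q1)] lies
     over [(c, d)], and [st] gives that limit a good neighborhood, which the ultrafilter would both
     contain and avoid. *)
  apply: contrapT => noO.
  have [|_ _ [U [V [O [cU dV gO ->]]]] [U' [V' [O' [cU' dV' gO' ->]]]]
      |_ [U [V [O [cU dV gO ->]]]]|W [UW BW]] :=
      @ultra_ext (M * M)%type (fun A => exists U V O,
      [/\ nbhs c U, nbhs d V, good O & A = sat U V `\` O]).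
  - by exists setT, setT, set0; split=> //; exact: filterT.
  - exists (sat (U `&` U') (V `&` V') `\` (O `|` O')); split.
      exists (U `&` U'), (V `&` V'), (O `|` O'); split=> //.
      + exact: filterI.
      + exact: filterI.
      + exact: goodU.
    move=> w [[[Uw U'w] [Vw V'w]] /not_orP[nO nO']].
    by split; split.
  - apply: contrapT => noW; apply: noO; exists U, V, O; split=> // w UVw.
    by apply: contrapT => nO; apply: noW; exists w.
  have [[p1 q1] Wlim] := ultra_lim id (@cdyn_compact _ (prod_cdyn M M)) UW.
  have cp : cls S' p1 = c.
    apply: (@cdyn_haus _ (qdyn hS')) => A B /cls_continuous pA cB.
    have W1 : W [set w : M * M | A (cls S' w.1)].
      exact: (Wlim _ (@fst_continuous M M (p1, q1) _ pA)).
    have W2 : W (sat B setT `\` set0).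
      by apply: BW; exists B, setT, set0; split=> //; exact: filterT.
    have W3 : W ([set w : M * M | A (cls S' w.1)] `&` (sat B setT `\` set0)) by exact: filterI.
    by have [w [Aw [[Bw _] _]]] := filter_ex W3; exists (cls S' w.1).
  have dq : cls S' q1 = d.
    apply: (@cdyn_haus _ (qdyn hS')) => A B /cls_continuous qA dB.
    have W1 : W [set w : M * M | A (cls S' w.2)].
      exact: (Wlim _ (@snd_continuous M M (p1, q1) _ qA)).
    have W2 : W (sat setT B `\` set0).
      by apply: BW; exists setT, B, set0; split=> //; exact: filterT.
    have W3 : W ([set w : M * M | A (cls S' w.2)] `&` (sat setT B `\` set0)) by exact: filterI.
    by have [w [Aw [[_ Bw] _]]] := filter_ex W3; exists (cls S' w.2).
  have S1 : S (p1, q1) by apply/(cls_eq hS); rewrite -!qmap_cls cp dq.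
  have [O pO gO] : exists2 O, nbhs ((p1, q1) : M * M) O & good O.
    apply: contrapT => noG; apply: ncd; rewrite -cp -dq; apply/(cls_eq hS').
    apply: st => // O pO; apply: contrapT => nw; apply: noG; exists O => // w Dw S'w.
    by apply: nw; exists w.
  apply: (ultra_notC UW (Wlim _ pO)).
  have : W (sat setT setT `\` O).
    by apply: BW; exists setT, setT, O; split=> //; exact: filterT.
  by apply: filterS => w [].
have [[e e'] [ecl /= ee]] := rp _ _ cU dV.
have cc : continuous (fun w : M * M => (cls S' w.1, cls S' w.2)).
  apply: pair_continuous.
    by apply: continuous_comp' (@cls_continuous _ _ _); exact: fst_continuous.
  by apply: continuous_comp' (@cls_continuous _ _ _); exact: snd_continuous.
have clD : closed ((fun w : M * M => (cls S' w.1, cls S' w.2)) @` D O).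
  apply: closed_image => //; last exact: closed_closure.
    exact: (@cdyn_compact _ (prod_cdyn M M)).
  exact: (@cdyn_haus _ (prod_cdyn (qdyn hS') (qdyn hS'))).
have : ((fun w : M * M => (cls S' w.1, cls S' w.2)) @` D O) (e, e').
  apply: clD; apply: closure_subset ecl => _ [t [[a b] [[/= [Ua Vb] ab] ->]]].
  exists (dact t (rep a), dact t (rep b)); last first.
    by rewrite /= -!(qt_act_cls hS') !repK.
  apply: subset_closure; exists t, (rep a, rep b); split=> //; split.
    by apply: UVO; rewrite /sat /= !repK.
  by apply/(cls_eq hS).
move=> [w Dw [ew e'w]]; apply: (gO w Dw); case: w {Dw} ew e'w => w1 w2 /= ew e'w.
by apply/(cls_eq hS'); rewrite ew e'w; exact: ee.
Qed.

End Quotients.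
End Factors.

(** * Construction of the PI-tower *)

Section Construction.
Variables (T : monoid) (M : umin T).
Local Notation "p ** z" := (@ma T M _ p z) (at level 40, left associativity).
Implicit Types (p q : M) (S : set (M * M)).

Variables (X Y : cdyn T) (pi : X -> Y) (phi : M -> X).
Hypothesis pi_ext : extension pi.
Hypothesis cphi : continuous phi.
Hypothesis ephi : forall t p, phi (dact t p) = dact t (phi p).
Hypothesis sphi : forall x, exists p, phi p = x.

Let SX : set (M * M) := [set w | phi w.1 = phi w.2].
Let SY : set (M * M) := [set w | pi (phi w.1) = pi (phi w.2)].

Let psi p : Y := pi (phi p).
Let cpsi : continuous psi.
Proof. by apply: continuous_comp' cphi _; case: pi_ext. Qed.
Let epsi t p : psi (dact t p) = dact t (psi p).
Proof. by rewrite /psi ephi; case: pi_ext => _ [->]. Qed.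

Let hSX : is_icer SX := icer_kernel cphi ephi.
Let hSY : is_icer SY := icer_kernel cpsi epsi.

Let R := \bigcap_(R' in [set R' | is_icer R' /\ prox_step R' SX]) R'.

Let hR : is_icer R.
Proof. by apply: icer_bigcap => S []. Qed.

Let RSX : R `<=` SX.
Proof. by move=> w; apply; split=> // p q. Qed.

Let RSY : R `<=` SY.
Proof. by move=> w /RSX; rewrite /SX /SY /= => ->. Qed.

Let Rprox : prox_step R SX.
Proof. by move=> p q Spq pq R' [_]; apply. Qed.

Let Rmin R' : is_icer R' -> R' `<=` R -> prox_step R' R -> R `<=` R'.
Proof.
move=> hR' R'R st w; apply; split=> // p q Spq pq.
by apply: st => //; exact: Rprox.
Qed.

Let step S S' := [/\ is_icer S', R `<=` S', S' `<=` S, S' <> S &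
  prox_step S' S \/ ap_step S' S].

(** The default value makes [next S = S] exactly when no proper step from [S] is left, so a fixed
    stage is terminal. *)
Let next S := xget S (step S).

Let next_sub S : next S `<=` S.
Proof. by rewrite /next; case: xgetP => [S' _ [_ _ ? _ _]|_]. Qed.

Let next_step S : next S <> S -> step S (next S).
Proof. by rewrite /next; case: xgetP => [S' _|]. Qed.

Let tow_icer S : tow SY next S -> is_icer S /\ R `<=` S.
Proof.
elim=> [|S' tS' [hS' RS']|C C0 _ IH]; first by split.
  by have [->|/next_step[? ? _ _ _]] := pselect (next S' = S'); split.
split; first by apply: icer_bigcap => S' /IH[].
by move=> w Rw S' /IH[_]; apply.
Qed.

Let I := tidx SY next.
Let hI (g : I) : is_icer (sval g) := (tow_icer (proj2_sig g)).1.
Let RI (g : I) : R `<=` sval g := (tow_icer (proj2_sig g)).2.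
Let top : I := ttop SY next.

Let top_terminal S' : is_icer S' -> R `<=` S' -> S' `<=` sval top ->
  prox_step S' (sval top) \/ ap_step S' (sval top) -> sval top `<=` S'.
Proof.
move=> hS' RS' S't st; have [->//|ne] := pselect (S' = sval top).
have : step (sval top) (next (sval top)).
  by rewrite /next; apply: (@xgetPex _ _ (step (sval top))); exists S'; split.
by case=> _ _ _; rewrite (ttop_next _ next_sub).
Qed.

Hypothesis uniq : forall L : set (X * X), diag X `<=` L -> L `<=` Rel pi ->
  closed L -> invariant_set (act2 T X) L -> M_set (act2 T X) L -> L = diag X.

Let top_R : sval top = R.
Proof.
pose L := (fun w : M * M => (phi w.1, phi w.2)) @` sval top.
have LM : M_set (act2 T X) L.
  by apply: (@terminal_mixing _ _ _ _ cphi ephi R (sval top)).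
have LE : L = diag X.
  apply: uniq => //.
  - move=> [x x'] /= xx; rewrite /diag /= in xx; subst x'.
    have [p pE] := sphi x; exists (p, p); last by rewrite /= pE.
    exact: icer_refl (hI top) p.
  - move=> _ [w Sw <-]; exact: (tow_sub next_sub (proj2_sig top) Sw).
  - apply: closed_image.
    + exact: (@cdyn_compact _ (prod_cdyn M M)).
    + exact: (@cdyn_haus _ (prod_cdyn X X)).
    + by apply: pair_continuous; [apply: continuous_comp' cphi; exact: fst_continuous|
        apply: continuous_comp' cphi; exact: snd_continuous].
    + exact: icer_closed (hI top).
  - move=> t _ [[p q] Spq <-]; exists (dact t p, dact t q); last by rewrite /= !ephi.
    exact: icer_act (hI top) _ _ _ Spq.
rewrite eqEsubset; split; last exact: RI.
(* As [L] is the diagonal, the top stage lies in [SX], whose a.p. pairs are in [R]; thus [R] is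
   itself a proximal step below the top. *)
apply: top_terminal => //; left=> p q Spq; apply: Rprox.
have : L (phi p, phi q) by exists (p, q).
by rewrite LE.
Qed.

Let minQ S (hS : is_icer S) : minimal_compact (qdyn hS).
Proof.
split; first exact: cdyn_compact; split; first exact: cdyn_haus.
apply: (@minimal_image T M (qdyn hS) (cls S)).
- exact: cls_continuous.
- by move=> t p; rewrite /= (qt_act_cls hS).
- by move=> c; exists (rep c); exact: repK.
- exact: um_minimal.
Qed.

Lemma PI_tower : PI_ext pi.
Proof.
have [u _ hu] : exists2 u : M, setT u & idem u.
  by apply: idem_exists => //; have [p _] := um_point M; exists p.
pose rho (c : qdyn hR) : X := phi (rep c).
have rho_cls p : rho (cls R p) = phi p.
  by apply/esym; exact: (RSX (rep_cls hR p)).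
have rho_ext : extension rho.
  split; last split.
  - apply: qt_continuous; rewrite (_ : _ \o _ = phi) //.
    by apply/funext => p /=; exact: rho_cls.
  - by move=> t c; rewrite -(repK c) /= (qt_act_cls hR) !rho_cls ephi.
  - by move=> x; have [p pE] := sphi x; exists (cls R p); rewrite rho_cls.
exists (qdyn hR), rho; split; first exact: minQ.
split=> //; split.
  apply: (@prox_ext_of _ _ X R hR rho) => p q; rewrite !rho_cls => pq.
  exists u => //; apply: Rprox; first exact: (icer_ma u hSX).
  by exists u => //; rewrite !maA hu.
exists I, (@tlt _ SY next), top; split; first exact: tlt_order next_sub.
split; first by move=> g; exact: ttop_max.
exists (fun g => qdyn (hI g)), (fun g => @qmap _ _ _ _ (hI g) hR),
  (fun l g => @qmap _ _ _ _ (hI l) (hI g)).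
split; first by move=> g; exact: minQ.
split; first by move=> g; apply: qmap_ext; exact: RI.
split.
  move=> l g [gl _]; split; first exact: qmap_ext.
  by move=> x; rewrite -(repK x) !qmap_cls //; exact: RI.
split.
  move=> g /tidx_least-/(_ next_sub) gE.
  have /choice[s sP] : forall y, exists p, psi p = y.
    move=> y; have [_ [_ spi]] := pi_ext; have [x <-] := spi y.
    by have [p <-] := sphi x; exists p.
  have gY p q : sval g (p, q) <-> psi p = psi q by rewrite gE.
  (* The least stage is [M / SY]. Continuity of [iota] comes from that of its inverse [kappa], by
     compactness. *)
  pose iota y : qdyn (hI g) := cls (sval g) (s y).
  pose kappa (c : qdyn (hI g)) := psi (rep c).
  have kcls p : kappa (cls _ p) = psi p.
    by apply/esym/gY; exact: (rep_cls (hI g)).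
  have ck : continuous kappa.
    apply: qt_continuous; rewrite (_ : _ \o _ = psi) //.
    by apply/funext => p /=; exact: kcls.
  have ki : cancel iota kappa by move=> y; rewrite kcls sP.
  have ik : cancel kappa iota.
    by move=> c; rewrite -(repK c) kcls; apply/(cls_eq (hI g))/gY; rewrite sP.
  have ci : continuous iota by exact: (bij_inv_continuous (@cdyn_compact _ _) (@cdyn_haus _ _) ck ik ki).
  exists iota; split.
    split; last by exists kappa.
    split=> //; split; last by move=> c; exists (kappa c).
    move=> t y; rewrite /= (qt_act_cls (hI g)); apply/(cls_eq (hI g))/gY.
    by rewrite epsi !sP.
  move=> x; rewrite -(repK x) qmap_cls; last exact: RI.
  by rewrite rho_cls; apply/(cls_eq (hI g))/gY; rewrite sP.
split.
  move=> g d gd /(tidx_next next_sub gd)[dE ne].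
  have [_ _ dg _ st] := next_step ne; rewrite -dE in dg st.
  by case: st => st; [left; exact: (qmap_prox dg hu st)|right; exact: qmap_ap].
split.
  move=> g gpred glim; split.
    move=> y1 y2; rewrite -(repK y1) -(repK y2).
    move: (rep y1) (rep y2) => p q H; apply/(cls_eq (hI g)).
    apply: (tidx_limit gpred glim) => l lg; have [gl _] := lg.
    by have := H l lg; rewrite !qmap_cls // => /(cls_eq (hI l)).
  move=> th thP.
  (* A compatible family is a chain of closed classes in [M]; any common point represents its
     limit. *)
  pose C := [set c : set M | exists2 l : I, tlt l g & c = [set p | cls (sval l) p = th l]].
  have clE (l : I) : [set p | cls (sval l) p = th l] = [set p | sval l (rep (th l), p)].
    rewrite eqEsubset; split=> p /=.
      by move=> <-; apply: (icer_sym (hI l)); exact: (rep_cls (hI l)).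
    by move=> H; rewrite -(repK (th l)); apply/(cls_eq (hI l))/(icer_sym (hI l)).
  have [|_ [l lg ->]|_ [l lg ->]|_ _ [l lg ->] [m mg ->]|p pP] := @chain_cap M (@cdyn_compact _ M) C.
  - by have [l lg] := gpred; eexists; exists l.
  - by rewrite clE; exact: class_closed (hI l) _.
  - by exists (rep (th l)); exact: repK.
  - have sub (l' m' : I) : tlt l' m' -> tlt m' g ->
        [set p | cls (sval m') p = th m'] `<=` [set p | cls (sval l') p = th l'].
      move=> lm m'g p /= pm; rewrite -(thP _ _ lm m'g) -pm qmap_cls //; exact: lm.1.
    have [_ [tri _]] := tlt_order SY next_sub.
    have [lm|[->|ml]] := tri l m; [right|left|left] => //; exact: sub.
  exists (cls (sval g) p) => l lg; rewrite qmap_cls; last exact: lg.1.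
  by apply: (pP [set p | cls (sval l) p = th l]); exists l.
split; first by apply: qmap_ext; exact: RI.
have tR : sval top `<=` R by rewrite top_R.
exists (@qmap _ _ _ _ hR (hI top)); split; first exact: qmap_continuous.
by split=> c; rewrite -(repK c) !qmap_cls //; exact: RI.
Qed.

End Construction.

Lemma PI_of_uniq (T : monoid) (X Y : cdyn T) (pi : X -> Y) :
  dyn_minimal X -> extension pi ->
  (forall L : set (X * X), diag X `<=` L -> L `<=` Rel pi ->
    closed L -> invariant_set (act2 T X) L -> M_set (act2 T X) L -> L = diag X) ->
  PI_ext pi.
Proof.
move=> mX pie uniq; have [M _] := umin_exists T.
have [[x0 _] _] := mX.
apply: (@PI_tower T M X Y pi (fun p => ma p x0)) => //.
- exact: ma_continuous.
- by move=> t p; rewrite dact_ma.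
- by move=> x; have [p pE] := @dyn_minimal_morb T M X x0 x mX; exists p.
Qed.

(** * Lifting M-dynamics *)

Section Lifting.
Variables (T : monoid) (M : umin T).
Local Notation "p ** z" := (@ma T M _ p z) (at level 40, left associativity).

Definition closed_inv (Z : dynamic T) (A : set Z) :=
  closed A /\ invariant_set (@dact T Z) A.

Lemma closed_inv_image (Y Z : cdyn T) (f : Y -> Z) (A : set Y) : continuous f ->
  (forall t y, f (dact t y) = dact t (f y)) -> closed_inv A -> closed_inv (f @` A).
Proof.
move=> cf ef [cA iA]; split; first exact: closed_image cA.
by move=> t _ [a Aa <-]; exists (dact t a); [exact: iA|rewrite ef].
Qed.

Lemma closed_inv_closure (Z : cdyn T) (A : set Z) :
  invariant_set (@dact T Z) A -> closed_inv (closure A).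
Proof.
move=> iA; split; first exact: closed_closure.
move=> t z cz V /dact_nbhs/cz[y [Ay Vy]].
by exists (dact t y); split=> //; exact: iA.
Qed.

Lemma ap_return (Z : cdyn T) (e : M) (z : Z) t V : e ** z = z -> nbhs z V ->
  exists s, V (dact s (dact t z)).
Proof.
move=> ez zV; have [p pE] := um_morb (dact t e) e.
have E : p ** dact t z = z by rewrite -{1}ez dact_ma maA pE.
have zV' : nbhs (p ** dact t z) V by rewrite E.
by have [s sV] := bt_ex (uactP zV'); exists s.
Qed.

Lemma ap_act (Z : cdyn T) (z : Z) t : ap_point (@dact T Z) z ->
  ap_point (@dact T Z) (dact t z).
Proof.
move=> /(@ap_fix T M)[e ee ez]; apply/(@ap_fix T M); apply: fix_idem.
have [p pE] := um_morb (dact t e) (dact t e); exists p.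
by rewrite -ez dact_ma maA pE.
Qed.

Lemma M_set_image (Y Z : cdyn T) (f : Y -> Z) (A : set Y) : continuous f ->
  (forall t y, f (dact t y) = dact t (f y)) -> M_set (@dact T Y) A ->
  M_set (@dact T Z) (f @` A).
Proof.
move=> cf ef [[a0 Aa0] [TT dens]].
have pre (U : set Z) : open U -> U `&` (f @` A) !=set0 ->
    open (f @^-1` U) /\ f @^-1` U `&` A !=set0.
  move=> oU [z [Uz [a Aa az]]]; rewrite -az in Uz; split; last by exists a.
  by have /continuousP := cf; apply.
split; first by exists (f a0), a0.
split.
  move=> U V oU oV /(pre _ oU)[oU' U'A] /(pre _ oV)[oV' V'A].
  have [t [x [Ax [Ux Vx]]]] := TT _ _ oU' oV' U'A V'A.
  by exists t, (f x); split; [exists x|split=> //; rewrite -ef].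
move=> W oW /(pre _ oW)[oW' W'A].
have [z [Az [Wz /(@ap_fix T M)[e ee ez]]]] := dens _ oW' W'A.
exists (f z); split; [by exists z|split=> //].
by apply/(@ap_fix T M); exists e => //; rewrite -ma_morph // ez.
Qed.

(** [B] is a minimal closed invariant set with image [A]: by minimality, an invariant subset of [B]
    whose image is dense in [A] is dense in [B]. An a.p. point lifts by applying its idempotent to
    any preimage. *)
Lemma M_set_lift (Y Z : cdyn T) (f : Y -> Z) (A : set Z) : continuous f ->
  (forall t y, f (dact t y) = dact t (f y)) -> (forall z, exists y, f y = z) ->
  closed_inv A -> M_set (@dact T Z) A ->
  exists B : set Y, [/\ closed_inv B, M_set (@dact T Y) B & f @` B = A].
Proof.
move=> cf ef sf [cA iA] [[a0 Aa0] [TT dens]].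
have [||B [[[cB iB] fB] _ Bmin]] := @zorn_min Y
  (fun B => closed_inv B /\ f @` B = A) (f @^-1` A).
- split; first split.
  + exact: closed_preim cA.
  + by move=> t y /= Ay; rewrite ef; exact: iA.
  + rewrite eqEsubset; split; first by move=> _ [y Ay <-].
    by move=> z Az; have [y yz] := sf z; exists y => //=; rewrite yz.
- move=> C [B0 CB0] CP Ctot; split; first split.
  + by apply: closed_bigI => B CB; have [[]] := CP _ CB.
  + by move=> t y Cy B CB; have [[_ iB] _] := CP _ CB; apply: iB; exact: Cy.
  + rewrite eqEsubset; split.
      by move=> _ [y Cy <-]; have [_ <-] := CP _ CB0; exists y => //; exact: Cy.
    move=> z Az.
    have [|_ [B CB <-]|_ [B CB <-]|_ _ [B CB <-] [D CD <-]|y yP] := @chain_cap Y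
      (@cdyn_compact _ Y) [set B `&` f @^-1` [set z] | B in C].
    * by exists (B0 `&` f @^-1` [set z]), B0.
    * apply: closedI; first by have [[]] := CP _ CB.
      by apply: closed_preim cf _; exact: (accessible_closed_set1 (hausdorff_accessible (@cdyn_haus _ Z))).
    * have [_ fBA] := CP _ CB; move: Az; rewrite -fBA => -[y By yz].
      by exists y.
    * by have [BD|DB] := Ctot _ _ CB CD; [left|right] => y [? ?]; split=> //; [exact: BD|exact: DB].
    exists y; first by move=> B CB; have [] := yP (B `&` f @^-1` [set z]) (ex_intro2 _ _ B CB erefl).
    by have [] := yP (B0 `&` f @^-1` [set z]) (ex_intro2 _ _ B0 CB0 erefl).
have Bsub D : closed_inv D -> D `<=` B -> A `<=` f @` D -> D = B.
  move=> [cD iD] DB AD; apply: Bmin => //; split=> //.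
  by rewrite eqEsubset; split=> // _ [d /DB Bd <-]; rewrite -fB; exists d.
have lift a : A a -> ap_point (@dact T Z) a ->
    exists y, [/\ B y, f y = a & ap_point (@dact T Y) y].
  rewrite -fB => -[y By yE] /(@ap_fix T M)[e ee ea].
  exists (e ** y); split; first exact: ma_inv.
    by rewrite ma_morph // yE.
  by apply/(@ap_fix T M); exists e => //; rewrite maA ee.
have clsub (D : set Y) : D `<=` B -> closure D `<=` B.
  by move=> DB y Dy; apply: cB; exact: closure_subset Dy.
have dense (D : set Y) : invariant_set (@dact T Y) D -> D `<=` B ->
    (forall N a, open N -> N a -> A a -> exists2 d, D d & N (f d)) -> closure D = B.
  move=> iD DB Dd; have ciD := closed_inv_closure iD.
  apply: Bsub => //; first exact: clsub.
  move=> a Aa; have [cfD _] := closed_inv_image cf ef ciD.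
  apply: cfD => N; rewrite nbhsE => -[O [oO Oa] ON].
  have [d Dd' Nd] := Dd O a oO Oa Aa.
  by exists (f d); split; [exists d => //; exact: subset_closure|exact: ON].
exists B; split=> //; split.
  have [y By _] : (f @` B) a0 by rewrite fB.
  by exists y.
split; last first.
  move=> W oW [y [Wy By]].
  have E : closure [set z | B z /\ ap_point (@dact T Y) z] = B.
    apply: dense; first by move=> t z [Bz az]; split; [exact: iB|exact: ap_act].
      by move=> z [].
    move=> N a oN Na Aa.
    have [|z [Az [Nz az]]] := dens N oN; first by exists a.
    by have [d [Bd dz ad]] := lift _ Az az; exists d => //; rewrite dz.
  have : closure [set z | B z /\ ap_point (@dact T Y) z] y by rewrite E.
  move=> /(_ W (open_nbhs_nbhs (conj oW Wy)))[z [[Bz az] Wz]].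
  by exists z.
move=> U V oU oV [x [Ux Bx]] [v [Vv Bv]]; apply: contrapT => noUV.
(* The points of [B] that never enter [V]: a proper closed invariant subset, whose image is
   therefore not all of [A]. Transitivity then puts a.p. points outside that image near every point
   of [A]. *)
pose D := B `&` [set y | forall t, ~ V (dact t y)].
have ciD : closed_inv D.
  split.
    apply: closedI => //.
    have -> : [set y | forall t, ~ V (dact t y)] = \bigcap_t [set y | (~` V) (dact t y)].
      by rewrite eqEsubset; split=> y /= H t => [_|]; exact: H.
    by apply: closed_bigI => t _; apply: dact_closed; exact: open_closedC.
  by move=> t y [By ny]; split; [exact: iB|move=> s; rewrite -dactM; exact: ny].
have [w0 Aw0 nw0] : exists2 w, A w & ~ (f @` D) w.
  apply: contrapT => no; have E : D = B.
    by apply: Bsub => // [y []//|a Aa]; apply: contrapT => na; apply: no; exists a.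
  have [_ /(_ (mone T))] : D v by rewrite E.
  by rewrite dact1.
have [cfD ifD] := closed_inv_image cf ef ciD.
(* Almost periodicity makes this set invariant: a translate of [z] still returns close to [z], hence
   reaches [V]. *)
pose D2 := [set z | [/\ B z, ap_point (@dact T Y) z & exists t, V (dact t z)]].
have E2 : closure D2 = B.
  apply: dense; last 2 first.
  - by move=> z [].
  - move=> N a oN Na Aa.
    have [||t [y [Ay [Ny ny]]]] := TT N (~` (f @` D)) oN (closed_openC cfD).
    + by exists a.
    + by exists w0.
    have [||z [Az [[Nz nz] az]]] := dens (N `&` ~` (f @` D)).
    + by apply: openI => //; exact: closed_openC.
    + by exists y; split=> //; split=> // Dy; apply: ny; exact: ifD.
    have [d [Bd dz ad]] := lift _ Az az; exists d; last by rewrite dz.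
    split=> //; apply: contrapT => /forallNP nV; apply: nz.
    by exists d.
  move=> t z [Bz az [s Vs]]; split; [exact: iB|exact: ap_act|].
  have [e ee ez] := (ap_fix M z).1 az.
  have nV : nbhs z [set y | V (dact s y)] by apply: dact_nbhs; exact: open_nbhs_nbhs.
  have [s' H] := ap_return t ez nV.
  by exists (mmul s s'); rewrite dactM.
have : closure D2 x by rewrite E2.
move=> /(_ U (open_nbhs_nbhs (conj oU Ux)))[z [[Bz _ [t Vt]] Uz]].
by apply: noUV; exists t, z.
Qed.

End Lifting.

(** * Minimality along proximal and almost periodic extensions *)

Section Steps.
Variables (T : monoid) (M : umin T).
Local Notation "p ** z" := (@ma T M _ p z) (at level 40, left associativity).
Variables (Z W : cdyn T) (psi : Z -> W).
Hypothesis cpsi : continuous psi.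
Hypothesis epsi : forall t z, psi (dact t z) = dact t (psi z).
Let ZZ := prod_cdyn Z Z.
Let WW := prod_cdyn W W.
Let psi2 : ZZ -> WW := fun w => (psi w.1, psi w.2).
Variable L : set ZZ.
Hypothesis ciL : closed_inv (L : set ZZ).
Hypothesis ML : M_set (@dact T ZZ) L.
Hypothesis minN : minimal_set (@dact T WW) (psi2 @` L).

Let cpsi2 : continuous psi2.
Proof.
apply: pair_continuous.
  by apply: continuous_comp' cpsi; exact: fst_continuous.
by apply: continuous_comp' cpsi; exact: snd_continuous.
Qed.

Let epsi2 t w : psi2 (dact t w) = dact t (psi2 w).
Proof. by rewrite /psi2 /= !epsi. Qed.

Let ciN : closed_inv (psi2 @` L).
Proof. exact: closed_inv_image. Qed.

Let psi2_ma p w : psi2 (p ** w) = p ** psi2 w.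
Proof. exact: (@ma_morph T M ZZ WW psi2). Qed.

Let psi_ma p z : psi (p ** z) = p ** psi z.
Proof. exact: (@ma_morph T M Z W psi). Qed.

Let L_ma p a : L a -> L (p ** a).
Proof. by case: ciL => cL iL; exact: ma_inv. Qed.

Let Norb a b : L a -> L b -> exists p : M, p ** psi2 a = psi2 b.
Proof.
have [cN iN] := ciN => La Lb.
have Na : (psi2 @` L) (psi2 a) by exists a.
have Nb : (psi2 @` L) (psi2 b) by exists b.
exact: (@minimal_morb T M WW _ _ _ minN cN iN Na Nb).
Qed.

Lemma minimal_of_dense a : L a ->
  (forall b, L b -> ap_point (@dact T ZZ) b -> morb M a b) ->
  minimal_set (@dact T ZZ) L.
Proof.
move=> La H; have [cL iL] := ciL.
have -> : L = morb M a; last exact: morb_minimal.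
rewrite eqEsubset; split; last by move=> _ [p <-]; exact: L_ma.
move=> b Lb; apply: morb_closed => V; rewrite nbhsE => -[O [oO Ob] OV].
have [|z [Lz [Oz az]]] := ML.2.2 O oO; first by exists b.
by exists z; split; [exact: H|exact: OV].
Qed.

(** Some [xi] merges [x] and [y], and an element [p] of [M] undoes [xi] on [e], hence on both
    points. *)
Lemma prox_fixed e x y : proximal_ext psi -> idem e -> psi x = psi y ->
  e ** x = x -> e ** y = y -> x = y.
Proof.
move=> prox ee xy ex ey.
have [_ [/(@orbit_closure T ZZ)[xi ->]]] := prox (x, y) xy.
rewrite uact_prod /diag /= => E.
have [p pE] := um_morb (uact xi e) e.
by rewrite -ex -ey -pE -!maA -!uact_ma ex ey E.
Qed.

Lemma prox_step_minimal : proximal_ext psi -> minimal_set (@dact T ZZ) L.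
Proof.
move=> prox; have [a La] := ML.1; apply: (minimal_of_dense La).
move=> b Lb /(@ap_fix T M)[e ee eb].
have [p pE] := Norb La Lb.
exists (e ** p); rewrite -maA.
have : psi2 (e ** (p ** a)) = psi2 b by rewrite !psi2_ma pE -psi2_ma eb.
have : e ** (e ** (p ** a)) = e ** (p ** a) by rewrite maA ee.
move: (e ** (p ** a)) => [x y]; case: b {Lb pE} eb => x' y'.
rewrite !ma_pair => -[ex' ey'] [ex ey] [xx' yy'].
by rewrite (prox_fixed prox ee xx') // (prox_fixed prox ee yy').
Qed.

Section APStep.
Hypothesis ap : ap_ext psi.

Lemma ap_distal xi x y : psi x = psi y -> uact xi x = uact xi y -> x = y.
Proof.
move=> xy E; apply: contrapT => nxy; apply: ap; exists x, y.
do 2!split=> //; move=> U V xU yV.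
exists (uact xi x, uact xi y); split; last by rewrite /diag /= E.
have : closure [set w : ZZ | exists t, w = dact t ((x, y) : ZZ)] (uact xi x, uact xi y).
  by apply/(@orbit_closure T ZZ); exists xi; rewrite uact_prod.
apply: closure_subset => _ [t ->]; exists t, (x, y); split=> //; split=> //.
by split; exact: nbhs_singleton.
Qed.

(** The points [e ** x] and [x] share a fibre and are merged by [e]; distality makes them equal. *)
Lemma ap_fixed e x : idem e -> e ** psi x = psi x -> e ** x = x.
Proof.
move=> ee ex; apply: (@ap_distal (uj e)); first by rewrite psi_ma.
by rewrite -/(ma e (ma e x)) maA ee.
Qed.

Lemma ap_fixed2 e w : idem e -> e ** psi2 w = psi2 w -> e ** w = w.
Proof.
case: w => x y ee; rewrite /psi2 /= !ma_pair => -[ex ey].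
by rewrite !ap_fixed.
Qed.

(** By transitivity there are [x] near [a] with a translate near [b]. In the fibre of each [x] lies
    a point [p ** a'] of the orbit of [a], also near [a]; its translates converge to some [c] in
    that orbit. Then [b] and [c] are regionally proximal in each coordinate, hence equal. *)
Lemma ap_fibre a b : L a -> L b -> psi2 a = psi2 b -> morb M a b.
Proof.
move=> La Lb ab; have [cL iL] := ciL; have [cN iN] := ciN.
set n := psi2 a in ab *.
have Nn : (psi2 @` L) n by exists a.
have [e ee en] := minimal_idem M minN cN iN Nn.
have ea : e ** a = a by exact: ap_fixed2.
have eb : e ** b = b by apply: ap_fixed2 => //; rewrite -ab.
(* An ultrafilter on triples replaces a net: [x] near [a], [t] moving [x] near [b], and [p] carrying
   [n] to the image of [x]. *)
pose base (U V : set ZZ) := [set w : ZZ * T * M |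
  [/\ L w.1.1, U w.1.1, V (dact w.1.2 w.1.1) & w.2 ** n = psi2 w.1.1]].
have [|_ _ [U [V [aU bV ->]]] [U' [V' [aU' bV' ->]]]|_ [U [V [aU bV ->]]]|F [UF BF]] :=
   @ultra_base (ZZ * T * M)%type
     (fun A => exists U V : set ZZ, [/\ nbhs a U, nbhs b V & A = base U V]).
- by exists (base setT setT), setT, setT; split=> //; exact: filterT.
- exists (base (U `&` U') (V `&` V')); split; last first.
    by move=> w [Lw [Uw U'w] [Vw V'w] nw].
  by exists (U `&` U'), (V `&` V'); split=> //; exact: filterI.
- have [||t [x [Lx [Ux Vx]]]] := ML.2.1 U^° V^° (open_interior _) (open_interior _).
  + by exists a.
  + by exists b.
  have [p pE] := Norb La Lx.
  by exists ((x, t), p); split=> //; exact: interior_subset.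
have FB (U V : set ZZ) : nbhs a U -> nbhs b V -> F (base U V).
  by move=> aU bV; apply: BF; exists U, V.
have [q qlim] := ultra_lim (fun w : ZZ * T * M => w.2) (@cdyn_compact _ M) UF.
have qn : q ** n = n.
  apply: (@ultra_lim_uniq WW _ F (fun w : ZZ * T * M => w.2 ** n)) => //.
    by move=> V /(@ma_continuous T M WW n q)/qlim.
  move=> V /cpsi2 nV; apply: filterS (FB _ _ nV filterT) => w [_ Vw _ wn].
  by rewrite /= wn.
have Geq : ellis_group e (e ** q) by exact: G_u.
(* The limit [q] of the [p] fixes [n] but possibly not [a]; starting from [a' = r ** a] corrects
   this, so that [p ** a'] tends to [a]. *)
set r := ginv e (e ** q).
have rn : r ** n = n.
  have nE : n = e ** (q ** n) by rewrite qn en.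
  by rewrite {1}nE (maA e) (maA r) (ginvl ee Geq) en.
set a' := r ** a.
have a'n : psi2 a' = n by rewrite psi2_ma rn.
have qa' : q ** a' = a.
  have qf : psi2 (q ** a') = n by rewrite psi2_ma a'n qn.
  rewrite -(@ap_fixed2 e (q ** a')) ?qf //.
  by rewrite /a' (maA q) (maA e) (maA e q) (ginvr ee Geq).
have [c clim] := ultra_lim (fun w : ZZ * T * M => dact w.1.2 (w.2 ** a'))
  (@cdyn_compact _ ZZ) UF.
have ac : morb M a c.
  apply: morb_closed => V /clim /filter_ex[[[x t] p] /= Vp].
  exists (dact t (p ** a')); split=> //.
  by exists (dact t (p ** r)); rewrite -dact_ma maA.
have bc : psi2 b = psi2 c.
  apply: (@ultra_lim_uniq WW _ F (fun w : ZZ * T * M => psi2 (dact w.1.2 (w.2 ** a')))) => //.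
    move=> V /cpsi2 bV; apply: filterS (FB _ _ filterT bV) => -[[x t] p] /= [_ _ Vx pn].
    by rewrite epsi2 psi2_ma a'n pn -epsi2.
  by move=> V /cpsi2/clim.
(* [ap] speaks of pairs in [Z], hence one coordinate [f] at a time. The pair near [(f b, f c)] is a
   translate of an a.p. pair near [(f a, f a)], so it can be moved back near the diagonal without
   inverting [t]. *)
have coord (f : ZZ -> Z) : continuous f -> (forall t w, f (dact t w) = dact t (f w)) ->
    (forall w w', psi2 w = psi2 w' -> psi (f w) = psi (f w')) -> f b = f c.
  move=> cf ef fpsi; apply: contrapT => nbc; apply: ap; exists (f b), (f c).
  split; first exact: fpsi.
  split=> // U V bU cV; exists (f a, f a); split=> // O [[O1 O2] /= [aO1 aO2] O12].
  have F1 : F (base (f @^-1` O1^°) (f @^-1` U)).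
    by apply: FB; [apply: cf; exact: nbhs_interior|exact: cf].
  have F2 : F [set w | O2^° (f (w.2 ** a'))].
    have cfa : continuous (fun p => f (p ** a')).
      by apply: continuous_comp' cf; exact: ma_continuous.
    by apply: (qlim [set p | O2^° (f (p ** a'))]); apply: cfa; rewrite qa'; exact: nbhs_interior.
  have F3 : F [set w | V (f (dact w.1.2 (w.2 ** a')))] by exact: (clim _ (cf _ _ cV)).
  have [[[x t] p] /= [[[Lx O1x Ux pn] O2p] Vp]] := filter_ex (filterI (filterI F1 F2) F3).
  rewrite /= in Lx O1x Ux pn O2p Vp.
  have Nx : (psi2 @` L) (psi2 x) by exists x.
  have [e' ee' e'n] := minimal_idem M minN cN iN Nx.
  have e'x : e' ** x = x by exact: ap_fixed2.
  have pa'x : psi2 (p ** a') = psi2 x by rewrite psi2_ma a'n pn.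
  have e'p : e' ** (p ** a') = p ** a' by apply: ap_fixed2 => //; rewrite pa'x.
  have fma p' w : f (p' ** w) = p' ** f w by exact: (@ma_morph T M ZZ Z f p' w cf ef).
  have vO : nbhs ((f x, f (p ** a')) : ZZ) O.
    by exists (O1, O2).
  have [|s sO] := @ap_return T M ZZ e' (f x, f (p ** a')) t O _ vO.
    by rewrite ma_pair -!fma e'x e'p.
  exists (dact s (dact t ((f x, f (p ** a')) : ZZ))); split=> //.
  exists s, (f (dact t x), f (dact t (p ** a'))); split; last by rewrite !ef.
  by split=> //; apply: fpsi; rewrite !epsi2 pa'x.
have -> // : b = c.
rewrite (surjective_pairing b) (surjective_pairing c).
have -> : b.1 = c.1.
  by apply: coord; [exact: (@fst_continuous Z Z)| |move=> w w' []].
have -> // : b.2 = c.2.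
by apply: coord; [exact: (@snd_continuous Z Z)| |move=> w w' []].
Qed.

Lemma ap_step_minimal : minimal_set (@dact T ZZ) L.
Proof.
have [a La] := ML.1; apply: (minimal_of_dense La) => b Lb _.
have [p pE] := Norb La Lb.
have [q qE] := ap_fibre (L_ma p La) Lb (etrans (psi2_ma p a) pE).
by exists (q ** p); rewrite -maA.
Qed.

End APStep.
End Steps.

(** * The equivalences *)

Lemma minimal_set_image (T : monoid) (Y Z : cdyn T) (f : Y -> Z) (A : set Y) :
  continuous f -> (forall t y, f (dact t y) = dact t (f y)) ->
  closed_inv A -> minimal_set (@dact T Y) A -> minimal_set (@dact T Z) (f @` A).
Proof.
move=> cf ef [cA iA] [[a Aa] minA]; split; first by exists (f a), a.
move=> B BfA [b Bb] cB iB; rewrite eqEsubset; split=> //.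
have E : A `&` f @^-1` B = A.
  apply: minA; first by move=> y [].
  - by have [y Ay yb] := BfA _ Bb; exists y; split=> //; rewrite /= yb.
  - by apply: closedI => //; exact: closed_preim cB.
  - by move=> t y [Ay By]; split; [exact: iA|rewrite /= ef; exact: iB].
by move=> _ [y Ay <-]; move: Ay; rewrite -E => -[].
Qed.

Lemma minimal_M_set (T : monoid) (Z : cdyn T) (A : set Z) :
  closed_inv A -> minimal_set (@dact T Z) A -> M_set (@dact T Z) A.
Proof.
have [M _] := umin_exists T; move=> [cA iA] mA; split; first exact: mA.1.
split.
  move=> U V oU oV [x [Ux Ax]] [y [Vy Ay]].
  have [p px] := minimal_morb M mA cA iA Ax Ay.
  have nV : nbhs (ma p x) V by rewrite px; exact: open_nbhs_nbhs.
  by have [t Vt] := bt_ex (uactP nV); exists t, x.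
move=> W _ [x [Wx Ax]]; exists x; split=> //; split=> //.
by apply/(ap_fix M); exact: (minimal_idem M mA cA iA).
Qed.

Lemma closed_inv_setT (T : monoid) (Z : cdyn T) : closed_inv [set: Z].
Proof. by split; [exact: closedT|]. Qed.

Section Square.
Variables (T : monoid) (Y Z : cdyn T) (f : Y -> Z).
Hypothesis cf : continuous f.
Hypothesis ef : forall t y, f (dact t y) = dact t (f y).

Definition square : prod_cdyn Y Y -> prod_cdyn Z Z := fun w => (f w.1, f w.2).

Lemma square_continuous : continuous square.
Proof.
apply: pair_continuous.
  by apply: continuous_comp' cf; exact: (@fst_continuous Y Y).
by apply: continuous_comp' cf; exact: (@snd_continuous Y Y).
Qed.

Lemma square_act t w : square (dact t w) = dact t (square w).
Proof. by rewrite /square /= !ef. Qed.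
End Square.

Lemma diag_minimal (T : monoid) (Z : cdyn T) : dyn_minimal Z ->
  closed_inv (diag Z : set (prod_cdyn Z Z)) /\
  minimal_set (@dact T (prod_cdyn Z Z)) (diag Z).
Proof.
move=> mZ; pose f (z : Z) : prod_cdyn Z Z := (z, z).
have cf : continuous f by apply: pair_continuous => z; exact: cvg_id.
have -> : diag Z = f @` setT.
  by rewrite eqEsubset; split=> [[x y]|_ [x _ <-] //]; rewrite /diag /= => ->; exists y.
split; first exact: closed_inv_image (closed_inv_setT Z).
exact: minimal_set_image (closed_inv_setT Z) mZ.
Qed.

Section PIMinimal.
Variables (T : monoid) (X : cdyn T) (Y : dynamic T) (pi : X -> Y).

Lemma PI_minimal : PI_ext pi ->
  forall L : set (X * X), L `<=` Rel pi -> closed L ->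
    invariant_set (act2 T X) L -> M_set (act2 T X) L ->
    minimal_set (act2 T X) L.
Proof.
move=> [X' [rho [mX' [rhoe [_ [I [lt [top [swo [_ [Yg [pg [psi [mY [epg [epsi [bot [succ [lim ttop]]]]]]]]]]]]]]]]]]].
have [cX' [hX' _]] := mX'; have [crho [erho srho]] := rhoe; have [_ [tri wf]] := swo.
move=> L Lpi cL iL ML; have [M _] := umin_exists T.
pose cX := @CDyn T X' cX' hX'.
pose cY g := @CDyn T (Yg g) (mY g).1 (mY g).2.1.
pose rho2 : prod_cdyn cX cX -> prod_cdyn X X := @square T cX X rho.
have crho2 : continuous rho2 by exact: (@square_continuous T cX X rho).
have erho2 t w : rho2 (dact t w) = dact t (rho2 w) by exact: (@square_act T cX X rho).
have [|L' [ciL' ML' L'L]] := M_set_lift M crho2 erho2 _ (conj cL iL) ML.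
  by move=> [x y]; have [a ax] := srho x; have [b bx] := srho y; exists (a, b); rewrite /rho2 /square /= ax bx.
pose pg2 g : prod_cdyn cX cX -> prod_cdyn (cY g) (cY g) := @square T cX (cY g) (pg g).
have cpg2 g : continuous (pg2 g).
  by apply: (@square_continuous T cX (cY g) (pg g)); case: (epg g).
have epg2 g t w : pg2 g (dact t w) = dact t (pg2 g w).
  by apply: (@square_act T cX (cY g) (pg g)); case: (epg g) => _ [].
pose Lg g := pg2 g @` L'.
have ciLg g : closed_inv (Lg g) by exact: closed_inv_image.
have MLg g : M_set (@dact T (prod_cdyn (cY g) (cY g))) (Lg g).
  exact: (M_set_image M).
pose psi2 l g : prod_cdyn (cY g) (cY g) -> prod_cdyn (cY l) (cY l) :=
  @square T (cY g) (cY l) (psi l g).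
have psiL l g : lt l g -> psi2 l g @` Lg g = Lg l.
  move=> lg; have [_ pE] := epsi l g lg.
  have pE2 w : psi2 l g (pg2 g w) = pg2 l w by rewrite /psi2 /pg2 /square /= !pE.
  rewrite eqEsubset; split; first by move=> _ [_ [w Lw <-] <-]; exists w => //; rewrite pE2.
  by move=> _ [w Lw <-]; exists (pg2 g w); [exists w|rewrite pE2].
have cpsi l g : lt l g -> continuous (psi l g) by move=> /epsi[[]].
have apsi l g : lt l g -> forall t y, psi l g (dact t y) = dact t (psi l g y).
  by move=> /epsi[[_ []]].
have key g : minimal_set (@dact T (prod_cdyn (cY g) (cY g))) (Lg g).
  elim: (wf g) => {}g _ IH.
  have [[l0 l0g]|nol] := pselect (exists l, lt l g); last first.
    have gmin l : ~ lt l g by move=> lg; apply: nol; exists l.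
    have [iota [_ pgE]] := bot g gmin.
    have [_ dmin] := @diag_minimal T (cY g) (mY g).2.2.
    (* [L] lies in [Rel pi], so its lift has diagonal image at the least stage, and the diagonal is
       minimal. *)
    have -> // : Lg g = diag (cY g).
    apply: dmin.2.
    - move=> _ [[x y] L'xy <-]; rewrite /pg2 /square /diag /= !pgE.
      have : L (rho2 (x, y)) by rewrite -L'L; exists (x, y).
      by move=> /Lpi; rewrite /Rel /rho2 /square /= => ->.
    - exact: (MLg g).1.
    - exact: (ciLg g).1.
    - exact: (ciLg g).2.
  (* At a limit stage, a closed invariant [B] maps onto every earlier [Lg l]. The points of [B]
     agreeing with [z] at stage [l] form a chain of closed sets; a common point agrees with [z] at
     all earlier stages, so it is [z]. *)
  have [glim|] := pselect (forall l, lt l g -> exists m, lt l m /\ lt m g).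
    have [inj _] := lim g (ex_intro _ l0 l0g) glim.
    split; first exact: (MLg g).1.
    move=> B BL [b Bb] cB iB; rewrite eqEsubset; split=> // z Lz.
    have psiB l : lt l g -> psi2 l g @` B = Lg l.
      move=> lg; have cps : continuous (psi2 l g).
        by apply: (@square_continuous T (cY g) (cY l)); exact: cpsi.
      have aps t w : psi2 l g (dact t w) = dact t (psi2 l g w).
        by apply: (@square_act T (cY g) (cY l)); exact: apsi.
      have [cpB ipB] := closed_inv_image cps aps (conj cB iB).
      apply: (IH l lg).2 => //; last by exists (psi2 l g b), b.
      by rewrite -(psiL l g lg) => _ [w /BL Lw <-]; exists w.
    pose C := [set D | exists2 l, lt l g & D = B `&` psi2 l g @^-1` [set psi2 l g z]].
    have [|_ [l lg ->]|_ [l lg ->]|_ _ [l lg ->] [m mg ->]|w wP] :=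
       @chain_cap _ (@cdyn_compact _ (prod_cdyn (cY g) (cY g))) C.
    - by exists (B `&` psi2 l0 g @^-1` [set psi2 l0 g z]), l0.
    - apply: closedI => //; apply: closed_preim.
        by apply: (@square_continuous T (cY g) (cY l)); exact: cpsi.
      exact: (accessible_closed_set1 (hausdorff_accessible (@cdyn_haus _ (prod_cdyn (cY l) (cY l))))).
    - have : Lg l (psi2 l g z) by rewrite -(psiL l g lg); exists z.
      by rewrite -psiB // => -[w Bw wz]; exists w.
    - have sub l' m' : lt l' m' -> lt m' g ->
          B `&` psi2 m' g @^-1` [set psi2 m' g z] `<=` B `&` psi2 l' g @^-1` [set psi2 l' g z].
        move=> lm m'g w [Bw wz]; split=> //; have lg' := swo.1 _ _ _ lm m'g.
        have fac y : psi l' g y = psi l' m' (psi m' g y).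
          have [_ [_ spg]] := epg g; have [x <-] := spg y.
          by rewrite (epsi _ _ lg').2 (epsi _ _ m'g).2 (epsi _ _ lm).2.
        move: wz; rewrite /psi2 /square /= => -[w1 w2].
        by rewrite !fac w1 w2.
      have [lm|[->|ml]] := tri l m; [right|left|left] => //; exact: sub.
    have Bw : B w by have [] := wP _ (ex_intro2 _ _ l0 l0g erefl).
    have -> // : z = w.
    case: z {Lz} w {Bw} @C wP => z1 z2 [w1 w2] C wP.
    have psiE l : lt l g -> psi2 l g (w1, w2) = psi2 l g (z1, z2).
      by move=> lg; have [] := wP _ (ex_intro2 _ _ l lg erefl).
    congr pair; apply: inj => l lg; have := psiE l lg; rewrite /psi2 /square /=.
      by case.
    by case.
  move=> /existsNP[m /not_implyP[mg /forallNP nom]].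
  have Lm := IH m mg; rewrite -(psiL m g mg) in Lm.
  have [prox|apx] := succ m g mg nom.
    exact: (@prox_step_minimal T M (cY g) (cY m) (psi m g) (cpsi _ _ mg) (apsi _ _ mg) (Lg g) (ciLg g) (MLg g) Lm prox).
  exact: (@ap_step_minimal T M (cY g) (cY m) (psi m g) (cpsi _ _ mg) (apsi _ _ mg) (Lg g) (ciLg g) (MLg g) Lm apx).
(* [pg top] is injective, so minimality at the top stage is minimality of the lift [L']; [rho2] then
   carries it to [L]. *)
have mL' : minimal_set (@dact T (prod_cdyn cX cX)) L'.
  have [_ [q [_ [pgK _]]]] := ttop.
  split; first exact: ML'.1.
  move=> B BL' [b Bb] cB iB; rewrite eqEsubset; split=> // z L'z.
  have [cpB ipB] := closed_inv_image (cpg2 top) (epg2 top) (conj cB iB).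
  have E : pg2 top @` B = Lg top.
    apply: (key top).2 => //; last by exists (pg2 top b), b.
    by move=> _ [w /BL' L'w <-]; exists w.
  have : Lg top (pg2 top z) by exists z.
  rewrite -E => -[[w1 w2] Bw []]; case: z {L'z} => z1 z2 /= E1 E2.
  by rewrite -(pgK z1) -(pgK z2) -E1 -E2 !pgK.
rewrite -L'L.
exact: (minimal_set_image crho2 erho2 ciL' mL').
Qed.

End PIMinimal.

Theorem theorem3p10 (T : monoid) (X Y : dynamic T) (pi : X -> Y) :
  minimal_compact X -> minimal_compact Y -> extension pi ->
  Rel pi <> diag X ->
  let P1 := PI_ext pi in
  let P2 := forall L : set (X * X), L `<=` Rel pi -> closed L ->
              invariant_set (act2 T X) L -> M_set (act2 T X) L ->
              minimal_set (act2 T X) L in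
  let P3 := M_set (act2 T X) (diag X) /\
            forall L : set (X * X), diag X `<=` L -> L `<=` Rel pi -> closed L ->
              invariant_set (act2 T X) L -> M_set (act2 T X) L -> L = diag X in
  (P1 <-> P2) /\ (P2 <-> P3) /\ (P1 <-> P3).
Proof.
move=> [cX [hX mX]] [cY [hY _]] epi _ P1 P2 P3.
pose X' := CDyn cX hX; pose Y' := CDyn cY hY.
have [[cd id] dmin] := @diag_minimal T X' mX.
have P12 : P1 -> P2 by exact: (@PI_minimal T X' Y pi).
have P23 : P2 -> P3.
  move=> H; split; first exact: (@minimal_M_set T (prod_cdyn X' X')).
  move=> L dL LR cL iL ML; apply/esym; have [_ mL] := H L LR cL iL ML.
  by apply: mL => //; exact: dmin.1.
have P31 : P3 -> P1.
  by move=> [_ H]; exact: (@PI_of_uniq T X' Y' pi).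
split; first by split=> // H; exact: P31 (P23 H).
split; first by split=> // H; exact: P12 (P31 H).
by split=> // H; exact: P23 (P12 H).
Qed.
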